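(* Let $T$ be a $k$-regular tree with $k\geq 3$, and let $\mu$ be the Haar measure on $\mathrm{Aut}(T)$ normalized so that vertex stabilizers have measure $1$. Let $n\geq 1$. Then for $\mu^{n}$-almost every $n$-tuple $(a_1,\ldots,a_n)\in\mathrm{Aut}(T)^n$ (where $\mu^n$ is the product measure), the group $\Gamma=\langle a_1,\ldots,a_n\rangle$ is a free group of rank $n$ that acts almost freely on $T$.
   Context: $\mathrm{Aut}(T)$ is the automorphism group of the tree $T$ with the topology of pointwise convergence; it is a locally compact, totally disconnected, unimodular topological group, and $\mu$ is an infinite measure. A subgroup $\Gamma\leq\mathrm{Aut}(T)$ acts almost freely if every $\gamma\in\Gamma$ with $\gamma\neq 1$ has finitely many fixed points (fixed vertices) on $T$; having none is allowed. *)

(* Defs.v *)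
From HB Require Import structures.
From mathcomp Require Import all_boot all_order all_algebra.
From mathcomp Require Import all_classical all_reals all_analysis.

Set Implicit Arguments.
Unset Strict Implicit.
Unset Printing Implicit Defensive.

Local Open Scope classical_set_scope.
Local Open Scope ring_scope.

Record graph := Graph {
  vertex :> choiceType;
  adj : rel vertex;
  adj_sym : symmetric adj;
  adj_irr : irreflexive adj
}.

Definition is_regular (k : nat) (T : graph) : Prop :=
  forall x : T, ([set y | adj x y] #= `I_k)%card.

Definition is_connected (T : graph) : Prop :=
  forall x y : T, exists2 p : seq T, path (@adj T) x p & last x p = y.

(* An edge traversed back and forth is a [ucycle] of size 2, so only the sizes
   from 3 on are excluded. *)
Definition is_acyclic (T : graph) : Prop :=
  forall c : seq T, ucycle (@adj T) c -> (size c <= 2)%N.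

Definition is_tree (T : graph) : Prop :=
  [/\ inhabited T, is_connected T & is_acyclic T].

Record aut (T : graph) := Aut {
  aut_fun :> T -> T;
  aut_bij : bijective aut_fun;
  aut_adj : forall x y, adj (aut_fun x) (aut_fun y) = adj x y
}.

Section AutGroup.
Variable T : graph.

Lemma aut_ext (f g : aut T) : f =1 g -> f = g.
Proof.
case: f g => [f fb fa] [g gb ga] /= /funext fg.
by case: _ / fg in gb ga *; congr Aut; exact: Prop_irrelevance.
Qed.

HB.instance Definition _ := gen_eqMixin (aut T).
HB.instance Definition _ := gen_choiceMixin (aut T).

Definition aut_one : aut T := @Aut T id (Bijective (frefl _) (frefl _))
  (fun x y => erefl).

Definition aut_mul (f g : aut T) : aut T :=
  @Aut T (f \o g) (bij_comp (aut_bij f) (aut_bij g))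
    (fun x y => etrans (aut_adj f (g x) (g y)) (aut_adj g x y)).

Lemma aut_inv_subproof (f : aut T) :
  exists g : aut T, cancel f g /\ cancel g f.
Proof.
have [g fK gK] := aut_bij f.
have ga x y : adj (g x) (g y) = adj x y by rewrite -(aut_adj f) !gK.
by exists (Aut (Bijective gK fK) ga).
Qed.

Definition aut_inv (f : aut T) : aut T := sval (cid (aut_inv_subproof f)).

Lemma aut_funK (f : aut T) : cancel f (aut_inv f).
Proof. exact: (svalP (cid (aut_inv_subproof f))).1. Qed.

Lemma aut_invK (f : aut T) : cancel (aut_inv f) f.
Proof. exact: (svalP (cid (aut_inv_subproof f))).2. Qed.

Lemma aut_mulA : associative aut_mul.
Proof. by move=> f g h; exact: aut_ext. Qed.

Lemma aut_mul1g : left_id aut_one aut_mul.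
Proof. by move=> f; exact: aut_ext. Qed.

Lemma aut_mulg1 : right_id aut_one aut_mul.
Proof. by move=> f; exact: aut_ext. Qed.

Lemma aut_mulVg : left_inverse aut_one aut_inv aut_mul.
Proof. by move=> f; apply: aut_ext => x; exact: aut_funK. Qed.

Lemma aut_mulgV : right_inverse aut_one aut_inv aut_mul.
Proof. by move=> f; apply: aut_ext => x; exact: aut_invK. Qed.

HB.instance Definition _ := isGroup.Build (aut T)
  aut_mulA aut_mul1g aut_mulg1 aut_mulVg aut_mulgV.

HB.instance Definition _ := isPointed.Build (aut T) aut_one.

(* The topology of pointwise convergence, the vertices being discrete. *)
HB.instance Definition _ := Topological.copy (aut T)
  (initial_topology
     (fun f : aut T => (f : T -> T) : {ptws T -> discrete_topology T})).

(* The Borel sigma-algebra. *)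
HB.instance Definition _ := Measurable.copy (aut T)
  (g_sigma_algebraType (@open (aut T))).

End AutGroup.

Definition stabilizer (T : graph) (x : T) : set (aut T) :=
  [set g | g x = x].

Section HaarMeasure.
Local Open Scope ereal_scope.
Variables (R : realType) (T : graph).

(* Nonzero left-invariant Radon measure. *)
Definition is_haar_measure (mu : {measure set (aut T) -> \bar R}) : Prop :=
  [/\ mu setT != 0,
      forall (g : aut T) A, measurable A -> mu [set (g * h)%g | h in A] = mu A,
      forall K : set (aut T), compact K -> mu K < +oo,
      forall A, measurable A ->
        mu A = ereal_inf [set mu U | U in [set U | open U /\ A `<=` U]] &
      forall U, open U ->
        mu U = ereal_sup [set mu K | K in [set K | compact K /\ K `<=` U]]].

End HaarMeasure.

(* [n.-tuple X] carries the product sigma-algebra.  For sigma-finite [mu] there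
   is exactly one measure on it with the prescribed values on measurable boxes;
   the convention 0 * +oo = 0 of [\bar R] is the one needed here. *)
Definition is_product_measure (R : realType) d (X : measurableType d)
    (mu : {measure set X -> \bar R}) (n : nat)
    (mun : {measure set (n.-tuple X) -> \bar R}) : Prop :=
  forall A : 'I_n -> set X, (forall i, measurable (A i)) ->
    mun [set a | forall i, A i (tnth a i)] =
    (\prod_(i < n) mu (A i))%E.

Section FreeGroups.
Local Open Scope group_scope.
Variable G : groupType.

Definition is_subgroup (H : set G) : Prop :=
  [/\ H 1, forall x y, H x -> H y -> H (x * y) & forall x, H x -> H x^-1].

Definition generated (A : set G) : set G := smallest is_subgroup A.

(* A word in the letters x_i and x_i^-1; [(i, true)] stands for x_i^-1. *)
Definition word (n : nat) := seq ('I_n * bool).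

Definition reduced n (w : word n) : bool :=
  sorted (fun u v => ~~ ((u.1 == v.1) && (u.2 != v.2))) w.

Definition eval_word n (b : 'I_n -> G) (w : word n) : G :=
  \prod_(l <- w) (if l.2 then (b l.1)^-1 else b l.1).

Definition is_free_basis n (H : set G) (b : 'I_n -> G) : Prop :=
  generated (range b) = H /\
  forall w : word n, reduced w -> w <> [::] -> eval_word b w <> 1.

Definition free_of_rank (n : nat) (H : set G) : Prop :=
  exists b : 'I_n -> G, is_free_basis H b.

End FreeGroups.

Definition acts_almost_freely (T : graph) (H : set (aut T)) : Prop :=
  forall g : aut T, H g -> g <> 1%g -> finite_set [set x : T | g x = x].

(* Main.v *)
Require Import Defs.
From HB Require Import structures.
From mathcomp Require Import all_boot all_order all_algebra.
From mathcomp Require Import all_classical all_reals all_analysis.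
From mathcomp Require Import perm zify ring lra.

(** Fix a root of the tree.  If some reduced word [w] in the generators fixes
infinitely many vertices, take a shortest such [w].  Far from the root all
letters of [w] commute with the parent map, and since proper subwords have
finitely many fixed vertices, the closed trajectory of a deep vertex fixed by
[w] never uses the same generator at the same vertex twice.  Rotate and, if
necessary, invert [w] so that the trajectory starts with a generator [g]
applied at a vertex [u0] that is at least as deep as all vertices at which
the trajectory uses a generator.

Let [S m] be the set of vertices fixed by [w] among the descendants of [u0] of
generation [m].  It is determined by the restriction of the tuple to the ball
of radius [depth u0 + m] about the root.  Given this restriction, precomposing
[g] with an automorphism that permutes the children of the vertices of [S m]
preserves the measure, and it precomposes the action of [w] on these children
with the same permutation, because no other step of the trajectories applies
[g] at a vertex of [S m].  So [#|S m|] behaves as a critical branching process: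
its expectation does not increase, and while it is at most [K] it drops to [0]
at the next step with probability at least some [c_K > 0].  Hence it almost
surely dies out, and there are countably many choices of [w], [g] and [u0]. *)

Set Implicit Arguments.
Unset Strict Implicit.
Unset Printing Implicit Defensive.
Import Order.TTheory GRing.Theory Num.Theory.

Local Open Scope ring_scope.
Local Open Scope nat_scope.
Local Open Scope classical_set_scope.

(** * Rooted trees *)

Section Distance.
Variables (T : graph) (o : T).
Hypotheses (Tconn : is_connected T) (Tacyc : is_acyclic T).

Let reach (x : T) (m : nat) :=
  `[< exists p : seq T, [/\ path (@adj T) o p, last o p = x & size p = m] >].

Lemma reach_ex x : exists m, reach x m.
Proof.
have [p pP lp] := Tconn o x.
by exists (size p); apply/asboolP; exists p.
Qed.

Definition dist x := ex_minn (reach_ex x).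

Lemma dist_path x : exists p : seq T,
  [/\ path (@adj T) o p, last o p = x & size p = dist x].
Proof. by rewrite /dist; case: ex_minnP => m /asboolP. Qed.

Lemma dist_le x p : path (@adj T) o p -> last o p = x -> (dist x <= size p)%N.
Proof.
move=> pP lp; rewrite /dist; case: ex_minnP => m _; apply.
by apply/asboolP; exists p.
Qed.

Lemma dist_root : dist o = 0%N.
Proof. by have := @dist_le o [::] erefl erefl; rewrite leqn0 => /eqP. Qed.

Lemma dist_eq0 x : (dist x == 0%N) = (x == o).
Proof.
apply/idP/eqP => [|->]; last by rewrite dist_root.
by have [[|y p] [_ <- <-]] := dist_path x.
Qed.

Lemma dist_adj x y : adj x y -> (dist y <= (dist x).+1)%N.
Proof.
move=> xy; have [p [pP lp <-]] := dist_path x.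
rewrite -(size_rcons p y); apply: dist_le; last by rewrite last_rcons.
by rewrite rcons_path pP lp.
Qed.

(* A path joining two neighbours of [x] without visiting [x] would close up to
   a cycle through [x]. *)
Lemma neighbour_path (x y z : T) p : adj x y -> adj x z -> y != z ->
  path (@adj T) y p -> last y p = z -> x \in y :: p.
Proof.
move=> xy xz yz yp lp; apply: contraT => xNp.
move: lp; case/shortenP: yp => p' p'P up' sp' lp.
have : ucycle (@adj T) (x :: y :: p').
  apply/andP; split; last first.
    rewrite cons_uniq up' andbT; apply: contra xNp.
    rewrite !inE => /orP[->//|/sp' ->]; by rewrite orbT.
  by rewrite /= rcons_path xy p'P lp adj_sym xz.
move/Tacyc; case: p' lp {p'P up' sp'} => //= lp.
by rewrite lp eqxx in yz.
Qed.

Lemma path_dist x p : path (@adj T) o p -> x \in o :: p ->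
  (dist x <= size p)%N /\ (dist x = size p -> last o p = x).
Proof.
move=> pP; rewrite inE => /orP[/eqP->|xp].
  by rewrite dist_root; split=> //; case: p {pP}.
case/splitPr: xp pP => p1 p2; rewrite cat_path last_cat /= => /and3P[p1P lx _].
have dx : (dist x <= (size p1).+1)%N.
  rewrite -(size_rcons p1 x); apply: dist_le; last by rewrite last_rcons.
  by rewrite rcons_path p1P.
rewrite size_cat /= addnS; split.
  by apply: leq_trans dx _; rewrite ltnS leq_addr.
by move=> e; move: dx; rewrite e ltnS -{2}[size p1]addn0 leq_add2l; case: p2 {e}.
Qed.

(** Geodesics from the root to [y] and to [z] miss [x]: by [path_dist], a vertex at least as far as
    the end of a geodesic can only be that end. Running back along one and out along the other then
    joins two neighbours of [x] without visiting [x], against [neighbour_path]. *)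
Lemma neighbour_dist x y z : adj x y -> adj x z ->
  (dist y <= dist x)%N -> (dist z <= dist x)%N -> y = z.
Proof.
move=> xy xz dy dz; apply/eqP/contraT => yz.
have [p [pP lp sp]] := dist_path y; have [q [qP lq sq]] := dist_path z.
have avoid (v : T) r : path (@adj T) o r -> last o r = v -> size r = dist v ->
  (dist v <= dist x)%N -> adj x v -> x \notin o :: r.
  move=> rP lr sr dv xv; apply/negP => /(path_dist rP)[d1 d2].
  have : last o r = x by apply: d2; lia.
  by rewrite lr => vx; move: xv; rewrite vx adj_irr.
have xNp := avoid _ _ pP lp sp dy xy.
have xNq := avoid _ _ qP lq sq dz xz.
have rP : path (@adj T) y (rev (belast o p)).
  by rewrite -lp rev_path; apply: sub_path pP => u v; rewrite /= adj_sym.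
have : x \in y :: (rev (belast o p) ++ q).
  apply: (neighbour_path xy xz yz); last first.
    rewrite last_cat; case: (p) lp => [|v p'] /= lp; first by rewrite -lp.
    by rewrite rev_cons last_rcons.
  rewrite cat_path rP /=; suff -> : last y (rev (belast o p)) = o by [].
  by case: (p) lp => [//|v p'] /= lp; rewrite rev_cons last_rcons.
rewrite inE mem_cat mem_rev => /or3P[/eqP xey|xp|xq].
- by move: xy; rewrite xey adj_irr.
- by rewrite (mem_belast xp) in xNp.
- by rewrite inE xq orbT in xNq.
Qed.

Lemma dist_parent x : x != o -> exists2 y, adj x y & dist x = (dist y).+1.
Proof.
rewrite -dist_eq0 => x0; have [p [pP lp sp]] := dist_path x.
case/lastP: p pP lp sp => [|p y]; first by move=> _ _ s0; rewrite -s0 in x0.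
rewrite rcons_path last_rcons size_rcons => /andP[pP ly] <-{x x0} sp.
exists (last o p); first by rewrite adj_sym.
apply/eqP; rewrite eqn_leq; apply/andP; split; first exact: dist_adj.
by rewrite -sp ltnS; exact: dist_le.
Qed.

Lemma adj_dist x y : adj x y ->
  dist x = (dist y).+1 \/ dist y = (dist x).+1.
Proof.
move=> xy; have yx : adj y x by rewrite adj_sym.
have := dist_adj xy; have := dist_adj yx => d1 d2.
have [/eqP xo|xo] := boolP (x == o).
  move: d1 d2 xy; rewrite xo dist_root => d1 d2.
  have [/eqP->|] := boolP (y == o); first by rewrite adj_irr.
  by rewrite -dist_eq0 => *; lia.
have [z xz dz] := dist_parent xo.
have [le|?] := leqP (dist y) (dist x); last by lia.
by rewrite (@neighbour_dist x y z) //; lia.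
Qed.

End Distance.

(** The tree has degree [d.+1]. The origin is left out of [size_children] because, having no parent,
    it has one child more; making it its own parent keeps iterates of [parent] total. *)
Record rooting (T : graph) (d : nat) := Rooting {
  origin : T;
  depth : T -> nat;
  parent : T -> T;
  children : T -> seq T;
  depth_eq0 : forall x, (depth x == 0%N) = (x == origin);
  depth_parent : forall x, x != origin -> depth x = (depth (parent x)).+1;
  parent_origin : parent origin = origin;
  adjE : forall x y, adj x y =
    ((x != origin) && (parent x == y)) || ((y != origin) && (parent y == x));
  children_uniq : forall x, uniq (children x);
  mem_children : forall x y, (y \in children x) = (y != origin) && (parent y == x);
  size_children : forall x, x != origin -> size (children x) = d
}.

Lemma regular_neighbours (T : graph) k (x : T) : is_regular k T ->
  exists s : seq T, [/\ uniq s, size s = k & forall y, (y \in s) = adj x y].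
Proof.
move=> /(_ x) e; exists (finmap.enum_fset (fset_set [set y | adj x y])); split.
- exact: finmap.fset_uniq.
- by rewrite (card_fset_set e).
- move=> y; rewrite in_fset_set; last by exists k.
  by apply/idP/idP; rewrite inE.
Qed.

Lemma rooting_exists (T : graph) d : is_tree T -> is_regular d.+1 T ->
  inhabited (rooting T d).
Proof.
case=> inT Tconn Tacyc reg; case: inT => o.
pose dp := dist o Tconn.
pose par x := xget o [set y | adj x y /\ dp x = (dp y).+1].
have parP x : x != o -> adj x (par x) /\ dp x = (dp (par x)).+1.
  move=> xo; rewrite /par; have [y xy dy] := dist_parent Tconn xo.
  by case: xgetP => [z _ //|/(_ y)]; case.
have parE x y : x != o -> adj x y -> dp x = (dp y).+1 -> par x = y.
  move=> xo xy dy; have [xp dp'] := parP _ xo.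
  by apply: (@neighbour_dist T o Tconn Tacyc x) => //; rewrite -/dp; lia.
have paro : par o = o.
  rewrite /par; case: xgetP => [y _ [_]|//].
  by rewrite {1}/dp dist_root.
have adjP x y : adj x y =
    ((x != o) && (par x == y)) || ((y != o) && (par y == x)).
  apply/idP/idP => [xy|].
    have [dx|dy] := adj_dist o Tconn Tacyc xy; apply/orP; [left|right].
      have xo : x != o by rewrite -(dist_eq0 o Tconn) dx.
      by rewrite xo /=; apply/eqP/parE.
    have yo : y != o by rewrite -(dist_eq0 o Tconn) dy.
    by rewrite yo /=; apply/eqP/parE => //; rewrite adj_sym.
  case/orP => /andP[xo /eqP <-]; first by have [] := parP _ xo.
  by rewrite adj_sym; have [] := parP _ xo.
have nbP x : {s : seq T | [/\ uniq s, size s = d.+1 & forall y, (y \in s) = adj x y]}.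
  by apply/cid/regular_neighbours.
pose nb x := sval (nbP x).
have nbu x : uniq (nb x) by rewrite /nb; case: (nbP x) => s [].
have nbs x : size (nb x) = d.+1 by rewrite /nb; case: (nbP x) => s [].
have nbm x y : (y \in nb x) = adj x y by rewrite /nb; case: (nbP x) => s [].
pose ch x := [seq y <- nb x | (y != o) && (par y == x)].
constructor; refine (@Rooting T d o dp par ch _ _ _ adjP _ _ _) => //.
- by move=> x; rewrite dist_eq0.
- by move=> x /parP[].
- by move=> x; rewrite filter_uniq.
- move=> x y; rewrite mem_filter nbm adjP.
  by case: (_ && (par y == x)); rewrite ?orbT ?andbF.
- move=> x xo; have pnb : par x \in nb x by rewrite nbm; case: (parP _ xo).
  (* Exactly one of the [d.+1] neighbours of [x] fails to be a child, namely its parent. *)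
  have -> : ch x = rem (par x) (nb x).
    rewrite rem_filter // /ch; apply: eq_in_filter => y.
    rewrite nbm adjP /= => xy; apply/idP/idP => [/andP[yo /eqP yx]|].
      apply/eqP => yp; have [_ d1] := parP _ xo; have [_ d2] := parP _ yo.
      by rewrite yx in d2; rewrite -yp in d1; lia.
    by move=> ypx; move: xy; rewrite (eq_sym (par x)) (negbTE ypx) andbF.
  by rewrite size_rem // nbs.
Qed.

(** * Automorphisms prescribed by local permutations *)

Section Portraits.
Variables (T : graph) (e : nat) (r : rooting T e.+1).
Local Notation o := (origin r).
Local Notation dep := (depth r).
Local Notation par := (parent r).
Local Notation ch := (children r).

Lemma mem_childrenP x y : reflect (y != o /\ par y = x) (y \in ch x).
Proof. by rewrite mem_children; apply: (iffP andP) => -[-> /eqP]. Qed.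

Lemma depth_child x y : y \in ch x -> dep y = (dep x).+1.
Proof. by case/mem_childrenP => /(depth_parent (r := r)) -> ->. Qed.

Definition label x : 'I_e.+1 := inord (index x (ch (par x))).
Definition child x (i : 'I_e.+1) := nth o (ch x) i.

Lemma mem_child x i : x != o -> child x i \in ch x.
Proof. by move=> xo; rewrite mem_nth // size_children. Qed.

Lemma labelK x y : x != o -> y \in ch x -> child x (label y) = y.
Proof.
move=> xo yx; have /mem_childrenP[yo ypx] := yx.
rewrite /child /label ypx inordK ?nth_index //.
by rewrite -[X in (_ < X)%N](size_children (r := r) xo) index_mem.
Qed.

Lemma childK x i : x != o -> label (child x i) = i.
Proof.
move=> xo; have /mem_childrenP[_ p] := mem_child i xo.
apply: val_inj; rewrite /= /label p inordK /child.
  by rewrite index_uniq ?children_uniq // size_children.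
by rewrite index_uniq ?children_uniq // size_children.
Qed.

Lemma child_inj x : x != o -> injective (child x).
Proof. by move=> xo i j /(congr1 label); rewrite !childK. Qed.

Variable s : T -> {perm 'I_e.+1}.

(* The subtree below the child of [x] labelled [i] is moved label by label onto
   the subtree below the child labelled [s x i]. *)

Fixpoint portrait_rec m x :=
  if m is m'.+1 then
    if par x == o then x
    else child (portrait_rec m' (par x)) (s (par x) (label x))
  else x.

Definition portrait_fun x := portrait_rec (dep x) x.
Local Notation h := portrait_fun.

Lemma portrait_funE x : par x != o ->
  h x = child (h (par x)) (s (par x) (label x)).
Proof.
move=> pxo; have xo : x != o by apply: contra pxo => /eqP ->; rewrite parent_origin.
by rewrite /h (depth_parent xo) /= (negbTE pxo).
Qed.

(** The origin has more children than there are labels, so portraits leave its children in place and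
    permute only below them. *)
Lemma portrait_fun_top x : par x = o -> h x = x.
Proof. by rewrite /h => pxo; case: (dep x) => //= m; rewrite pxo eqxx. Qed.

Lemma parent_ind (P : T -> Prop) :
  (forall x, par x = o -> P x) ->
  (forall x, x != o -> par x != o -> P (par x) -> P x) -> forall x, P x.
Proof.
move=> P0 PS x; have [m le] := ubnP (dep x).
elim: m x le => // m IH x le; have [/eqP/P0//|pxo] := boolP (par x == o).
have xo : x != o by apply: contra pxo => /eqP ->; rewrite parent_origin.
by apply: PS => //; apply: IH; move: le; rewrite (depth_parent xo).
Qed.

Lemma portrait_par x : [/\ dep (h x) = dep x, par (h x) = h (par x) &
   (h x == o) = (x == o)].
Proof.
elim/parent_ind: x => x.
  by move=> pxo; rewrite portrait_fun_top // pxo portrait_fun_top ?parent_origin.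
move=> xo pxo [IHd IHp IHo]; rewrite portrait_funE //.
have hpo : h (par x) != o by rewrite IHo.
have /[dup]/mem_childrenP[co cp] := mem_child (s (par x) (label x)) hpo.
move=> /depth_child ->.
by rewrite IHd cp (negbTE xo) (negbTE co) (depth_parent xo).
Qed.

Lemma portrait_inj : injective h.
Proof.
elim/parent_ind => x.
  move=> pxo y; rewrite portrait_fun_top // => xy.
  have pyo : par y = o.
    apply/eqP; have [_ _ <-] := portrait_par (par y).
    by have [_ <- _] := portrait_par y; rewrite -xy pxo.
  by rewrite xy portrait_fun_top.
move=> xo pxo IH y hxy.
have pxy : par x = par y.
  apply: IH; have [_ <- _] := portrait_par x.
  by have [_ <- _] := portrait_par y; rewrite hxy.
have yo : y != o.
  have [_ _ <-] := portrait_par y; rewrite -hxy.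
  by have [_ _ ->] := portrait_par x.
move: hxy; rewrite (portrait_funE pxo) (@portrait_funE y) -pxy //.
have hpo : h (par x) != o by have [_ _ ->] := portrait_par (par x).
move/(child_inj hpo)/perm_inj/(congr1 (child (par x))).
by rewrite !labelK //; apply/mem_childrenP; rewrite ?pxy.
Qed.

Lemma portrait_surj y : exists x, h x = y.
Proof.
elim/parent_ind: y => y; first by exists y; rewrite portrait_fun_top.
move=> yo pyo [p hp].
have po : p != o by have [_ _ <-] := portrait_par p; rewrite hp.
exists (child p ((s p)^-1%g (label y))).
have /mem_childrenP[_ cp] := mem_child ((s p)^-1%g (label y)) po.
rewrite portrait_funE cp // childK // permKV hp labelK //.
by apply/mem_childrenP.
Qed.

Lemma portrait_adj x y : adj (h x) (h y) = adj x y.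
Proof.
rewrite !(adjE r); have [_ -> ->] := portrait_par x.
have [_ -> ->] := portrait_par y.
by rewrite !(inj_eq portrait_inj).
Qed.

Lemma portrait_bij : bijective h.
Proof.
have [g gP] := choice portrait_surj.
by exists g => // x; apply: portrait_inj; rewrite gP.
Qed.

Definition portrait : aut T := Aut portrait_bij portrait_adj.

Lemma portrait_id x : (forall p, (dep p < dep x)%N -> s p = 1%g) ->
  portrait x = x.
Proof.
rewrite /=; elim/parent_ind: x => x; first by move=> pxo _; rewrite portrait_fun_top.
move=> xo pxo IH s1; have lt : (dep (par x) < dep x)%N.
  by rewrite (depth_parent xo).
rewrite portrait_funE // IH; last by move=> p pp; apply/s1/(ltn_trans pp).
by rewrite s1 // perm1 labelK //; apply/mem_childrenP.
Qed.

Lemma portrait_child x y : x != o -> portrait x = x -> y \in ch x ->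
  portrait y = child x (s x (label y)).
Proof.
rewrite /= => xo hx /mem_childrenP[yo px].
by rewrite portrait_funE px // hx.
Qed.

Lemma portrait_par_id x : portrait (par x) = par x -> s (par x) = 1%g ->
  portrait x = x.
Proof.
rewrite /= => hp sp; have [/portrait_fun_top//|pxo] := eqVneq (par x) o.
rewrite portrait_funE // hp sp perm1 labelK //; apply/mem_childrenP; split=> //.
by apply: contra_neq pxo => ->; rewrite parent_origin.
Qed.

Lemma portrait_depth x : dep (portrait x) = dep x.
Proof. by have [] := portrait_par x. Qed.

End Portraits.

(** * Trajectories of words *)

Section Words.
Variables (T : graph) (n : nat).
Implicit Types (a b : 'I_n -> aut T) (l : 'I_n * bool) (w : word n) (x : T).

Definition lact a l : T -> T := (if l.2 then (a l.1)^-1 else a l.1)%g.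

Definition ev a w x := foldr (lact a) x w.

(* The step [x |-> lact a l x] uses the value of the generator [a l.1] at one
   vertex, namely [(edge a l x).2]. *)
Definition edge a l x := (l.1, if l.2 then lact a l x else x).

(** Words act from their right end, so the list runs backwards in time: its last entry is the first
    step taken from [x]. *)
Fixpoint edges a w x :=
  if w is l :: w' then edge a l (ev a w' x) :: edges a w' x else [::].

Lemma eval_wordE a w x : (eval_word a w : aut T) x = ev a w x.
Proof.
rewrite /eval_word; elim: w => [|l w IH]; first by rewrite big_nil.
by rewrite big_cons /= -IH.
Qed.

Lemma ev_cat a w1 w2 x : ev a (w1 ++ w2) x = ev a w1 (ev a w2 x).
Proof. by rewrite /ev foldr_cat. Qed.

Lemma edges_cat a w1 w2 x :
  edges a (w1 ++ w2) x = edges a w1 (ev a w2 x) ++ edges a w2 x.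
Proof. by elim: w1 => //= l w1 ->; rewrite ev_cat. Qed.

Lemma size_edges a w x : size (edges a w x) = size w.
Proof. by elim: w => //= l w ->. Qed.

Definition flip l := (l.1, ~~ l.2).

Lemma lactK a l : cancel (lact a l) (lact a (flip l)).
Proof.
by case: l => i [] x; rewrite /lact /=; [exact: aut_invK | exact: aut_funK].
Qed.

Lemma lact_inj a l : injective (lact a l).
Proof. exact: can_inj (@lactK a l). Qed.

Lemma lact_adj a l x y : adj (lact a l x) (lact a l y) = adj x y.
Proof. exact: aut_adj. Qed.

Lemma ev_inj a w : injective (ev a w).
Proof. by elim: w => // l w IH x y /lact_inj/IH. Qed.

Definition winv w := rev (map flip w).

Lemma ev_winv a w x : ev a (winv w) (ev a w x) = x.
Proof.
elim: w => //= l w IH; rewrite /winv /= rev_cons -cats1 ev_cat /= lactK.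
exact: IH.
Qed.

(** A step and its reversal read the same value of the same generator; hence reversing a trajectory
    keeps its edges. *)
Lemma edge_flip a l x : edge a (flip l) (lact a l x) = edge a l x.
Proof.
by case: l => i []; rewrite /edge //=; congr pair; rewrite (lactK a (i, false)).
Qed.

Lemma edges_winv a w x : edges a (winv w) (ev a w x) = rev (edges a w x).
Proof.
elim: w => //= l w IH; rewrite /winv /= rev_cons -cats1 edges_cat /=.
by rewrite lactK IH edge_flip rev_cons -cats1.
Qed.

(** For an inverse letter, the agreement says that [b] sends the old image of [x] back to [x], which
    determines its inverse at [x]. A trajectory therefore depends only on the values of the
    generators at its edges. *)
Lemma edgeE a b l x :
  b (edge a l x).1 (edge a l x).2 = a (edge a l x).1 (edge a l x).2 ->
  lact b l x = lact a l x /\ edge b l x = edge a l x.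
Proof.
case: l => i []; rewrite /edge /lact /= => e; last by rewrite e.
have bx : b i ((a i)^-1%g x) = x by rewrite e; exact: (aut_invK (a i)).
have -> : (b i)^-1%g x = (a i)^-1%g x; last by [].
by rewrite -{1}bx; exact: (aut_funK (b i)).
Qed.

Lemma ev_agree a b w x :
  (forall e, e \in edges a w x -> b e.1 e.2 = a e.1 e.2) ->
  ev b w x = ev a w x /\ edges b w x = edges a w x.
Proof.
elim: w => //= l w IH H.
have [|-> ->] := IH; first by move=> e ew; apply: H; rewrite inE ew orbT.
have [|-> ->] := @edgeE a b l (ev a w x); last by [].
by apply: H; rewrite inE eqxx.
Qed.

End Words.

(** * Descendants and words commuting with the parent map *)

Section Descendants.
Variables (T : graph) (d n : nat) (r : rooting T d).
Local Notation o := (origin r).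
Local Notation dep := (depth r).
Local Notation par := (parent r).
Local Notation ch := (children r).
Implicit Types (a b : 'I_n -> aut T) (l : 'I_n * bool) (w : word n) (x u : T).

Fixpoint desc m u :=
  if m is m'.+1 then flatten [seq ch x | x <- desc m' u] else [:: u].

Lemma mem_descS m u y : (y \in desc m.+1 u) = (y != o) && (par y \in desc m u).
Proof.
apply/flattenP/andP => /= [[s /mapP[x xm ->]]|[yo ym]].
  by rewrite mem_children => /andP[-> /eqP->].
by exists (ch (par y)); [exact: map_f | rewrite mem_children yo /=].
Qed.

Lemma mem_desc m u x :
  (x \in desc m u) = (iter m par x == u) && (dep x == dep u + m)%N.
Proof.
elim: m x => [|m IH] x.
  by rewrite inE /= addn0; case: eqP => [->|//]; rewrite eqxx.
rewrite mem_descS IH iterSr; case: (_ == u); rewrite ?andbF //=.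
have [->|xo] := eqVneq x o.
  have -> : dep o = 0%N by apply/eqP; rewrite depth_eq0.
  by rewrite addnS.
by rewrite (depth_parent xo) addnS eqSS.
Qed.

Lemma depth_desc m u x : x \in desc m u -> dep x = (dep u + m)%N.
Proof. by rewrite mem_desc => /andP[_ /eqP]. Qed.

(** The condition is imposed on every suffix of [w], so that the trajectory of [par x] stays one
    level above that of [x] at each step. *)
Fixpoint parent_compat a w x := if w is l :: w' then
    [&& parent_compat a w' x, ev a w x != o & par (ev a w x) == ev a w (par x)]
  else x != o.

Lemma compat_parent a w x : parent_compat a w x -> par (ev a w x) = ev a w (par x).
Proof. by case: w => //= l w /and3P[_ _ /eqP]. Qed.

Lemma compat_neq a w x : parent_compat a w x -> ev a w x != o.
Proof. by case: w => //= l w /and3P[]. Qed.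

Lemma compat_cat a w1 w2 x : 
  parent_compat a (w1 ++ w2) x =
  parent_compat a w2 x && parent_compat a w1 (ev a w2 x).
Proof.
elim: w1 => [|l w1 IH] /=.
  by apply/idP/andP => [p|[]//]; split=> //; exact: compat_neq.
rewrite IH -!/(ev _ _ _) !ev_cat; case p2: (parent_compat a w2 x) => //=.
by rewrite (compat_parent p2).
Qed.

Local Notation parE := (fun e : 'I_n * T => (e.1, par e.2)).

Lemma compat_edges a w x : parent_compat a w x ->
  edges a w (par x) = map parE (edges a w x).
Proof.
elim: w => //= l w IH /and3P[px _ /eqP lx]; rewrite IH //; congr cons.
by rewrite /edge /= -lx -(compat_parent px); case: l.2.
Qed.

Lemma compat_agree a b w x :
  (forall e, e \in edges a w x ->
     b e.1 e.2 = a e.1 e.2 /\ b e.1 (par e.2) = a e.1 (par e.2)) ->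
  parent_compat a w x -> parent_compat b w x.
Proof.
elim: w => //= l w IH H /and3P[px lo /eqP lx].
have pcl : parent_compat a (l :: w) x by rewrite /= px lo lx eqxx.
have -> : parent_compat b w x by apply: IH => // e ew; apply: H; rewrite inE ew orbT.
have [/= -> _] : ev b (l :: w) x = ev a (l :: w) x /\
    edges b (l :: w) x = edges a (l :: w) x.
  by apply: ev_agree => e /H[].
have [/= -> _] : ev b (l :: w) (par x) = ev a (l :: w) (par x) /\
    edges b (l :: w) (par x) = edges a (l :: w) (par x).
  by apply: ev_agree => e; rewrite (compat_edges pcl) => /mapP[f /H[_ ?] ->].
by rewrite lo /= lx eqxx.
Qed.

(** The image of [y] is a neighbour of the image of [u]. It is not the parent of that image, since
    this parent is the image of [par u] and automorphisms are injective; so it is a child. *)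
Lemma compat_child a w u y : parent_compat a w u -> y \in ch u ->
  [/\ parent_compat a w y, ev a w y \in ch (ev a w u),
      all (fun e => e.2 != o) (edges a w y) &
      map parE (edges a w y) = edges a w u].
Proof.
move=> + yu; have /andP[yo /eqP yp] : (y != o) && (par y == u).
  by rewrite -mem_children.
elim: w => [|l w IH] /=; first by [].
move=> /and3P[pu luo /eqP lup]; have [py ey ay my] := IH pu.
have /[1!mem_children]/andP[eyo /eqP eyp] := ey.
have npar : ev a w y != par (ev a w u).
  apply/eqP => e; have := depth_parent eyo; rewrite eyp.
  by have := depth_parent (compat_neq pu); rewrite e; lia.
have : adj (ev a w y) (ev a w u) by rewrite (adjE r) eyo eyp eqxx.
have lne : lact a l (ev a w y) != par (lact a l (ev a w u)).
  by rewrite lup (inj_eq (@lact_inj _ _ a l)) -(compat_parent pu).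
rewrite -(lact_adj a l) (adjE r) => /orP[/andP[lyo /eqP lyp]|]; last first.
  by case/andP => _ /eqP e; rewrite e eqxx in lne.
rewrite py my lyo lyp ay mem_children lyo lyp eqxx /=.
rewrite yp eqxx; split=> //; rewrite /edge.
  by case: (l.2); rewrite /= ?lyo ?eyo.
by case: (l.2); rewrite /= ?lyp ?eyp.
Qed.

(** Iterating [compat_child] makes the trajectory of a descendant a lift of that of [u]. Depth
    bounds and distinctness of edges thereby pass from a base vertex to everything below it. *)
Lemma compat_desc a w u m x : parent_compat a w u -> x \in desc m u ->
  [/\ parent_compat a w x, ev a w x \in desc m (ev a w u),
      {in edges a w x, forall e, dep e.2 = (dep (iter m par e.2) + m)%N} &
      map (fun e => (e.1, iter m par e.2)) (edges a w x) = edges a w u].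
Proof.
move=> pu; elim: m x => [|m IH] x.
  rewrite mem_seq1 => /eqP ->; split=> //; first by rewrite mem_seq1.
    by move=> e _; rewrite addn0.
  by rewrite -[RHS]map_id; apply: eq_map => -[].
rewrite mem_descS => /andP[xo /IH[px evx dx mx]].
have [|pcx ecx acx mcx] := @compat_child a w (par x) x px.
  by rewrite mem_children xo /=.
have mem1 e : e \in edges a w x -> parE e \in edges a w (par x).
  by move=> ex; rewrite -mcx; exact: map_f.
split=> //.
- by move: ecx; rewrite mem_descS mem_children => /andP[-> /eqP ->].
- move=> e ex; rewrite iterSr (depth_parent (allP acx _ ex)).
  by rewrite (dx _ (mem1 _ ex)) addnS.
- rewrite -mx -mcx -map_comp; apply: eq_map => -[i v] /=.
  by rewrite -iterSr.
Qed.

End Descendants.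

(** * Cylinders *)

Lemma open_eval (T : graph) (x y : T) : open [set f : aut T | f x = y].
Proof.
have c : continuous (fun f : aut T => (f x : discrete_topology T)).
  move=> f.
  apply: (@continuous_comp (aut T) {ptws T -> discrete_topology T}
    (discrete_topology T) (fun f : aut T => (f : T -> T)) (fun g => g x)).
    exact: initial_continuous.
  exact: (@proj_continuous T (fun=> discrete_topology T) x).
have : open ((fun f : aut T => (f x : discrete_topology T)) @^-1` [set y]).
  apply: open_comp; first by move=> f _; exact: c.
  exact: discrete_open.
by [].
Qed.

Lemma measurable_eval (T : graph) (x y : T) :
  measurable [set f : aut T | f x = y].
Proof. by apply: sub_sigma_algebra; exact: open_eval. Qed.

Lemma measure_partition d (X : measurableType d) (R : realType)
    (m : {measure set X -> \bar R}) (c : X -> nat) (A : set X) :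
  (forall k, measurable (A `&` [set a | c a = k])) ->
  m A = (\sum_(k <oo) m (A `&` [set a | c a = k]))%E.
Proof.
move=> mA; have AE : A = \bigcup_k (A `&` [set a | c a = k]).
  by apply/seteqP; split=> [a Aa|a [k _ []]] //; exists (c a).
rewrite {1}AE measure_semi_bigcup //.
- by move=> i j _ _ [a [[_ <-] [_ <-]]].
- exact: bigcupT_measurable.
Qed.

Section Cylinders.
Variables (T : graph) (d n : nat) (r : rooting T d).
Local Notation o := (origin r).
Local Notation dep := (depth r).
Local Notation par := (parent r).
Local Notation X := (n.-tuple (aut T)).
Implicit Types (a b : X) (A B : set X).

Lemma iter_par_depth x : iter (dep x) par x = o.
Proof.
move e : (dep x) => m; elim: m x e => [|m IH] x e.
  by apply/eqP; rewrite -(depth_eq0 r) e.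
rewrite iterSr IH //; have xo : x != o by rewrite -(depth_eq0 r) e.
by move: (depth_parent xo); rewrite e => -[].
Qed.

Lemma mem_desc_origin m x : (x \in desc r m o) = (dep x == m).
Proof.
have d0 : dep o = 0 by apply/eqP; rewrite depth_eq0.
rewrite mem_desc d0 add0n; apply/andP/idP => [[]//|/eqP <-].
by rewrite iter_par_depth.
Qed.

(** Vertices form only a choice type; depth and position within the finite level number them, which
    makes conditioning on a ball a countable partition. *)
Definition vcode (x : T) : nat := pickle (dep x, index x (desc r (dep x) o)).

Lemma vcode_inj : injective vcode.
Proof.
move=> x y /(pcan_inj pickleK)[dxy]; rewrite -dxy => exy.
have xm : x \in desc r (dep x) o by rewrite mem_desc_origin.
have ym : y \in desc r (dep x) o by rewrite mem_desc_origin dxy.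
by rewrite -(nth_index o xm) exy nth_index.
Qed.

Definition tree_ball N : seq T := flatten [seq desc r m o | m <- iota 0 N.+1].

Lemma mem_tree_ball N x : (x \in tree_ball N) = (dep x <= N).
Proof.
apply/flattenP/idP => [[_ /mapP[m mN ->]]|xN].
  by rewrite mem_desc_origin => /eqP ->; move: mN; rewrite mem_iota; lia.
exists (desc r (dep x) o); last by rewrite mem_desc_origin.
by apply/mapP; exists (dep x) => //; rewrite mem_iota; lia.
Qed.

Lemma measurable_eq_on_ball N (g : T -> T) :
  measurable [set f : aut T | forall x, dep x <= N -> f x = g x].
Proof.
have -> : [set f : aut T | forall x, dep x <= N -> f x = g x] =
    \bigcap_(x in [set` tree_ball N]) [set f : aut T | f x = g x].
  apply/seteqP; split=> [f fN x /=|f fN x xN].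
    by rewrite mem_tree_ball; exact: fN.
  by apply: fN; rewrite /= mem_tree_ball.
apply: fin_bigcap_measurable => [|x _]; first exact: finite_seq.
exact: measurable_eval.
Qed.

Definition agree N a b : Prop :=
  forall i x, (dep x <= N)%N -> tnth b i x = tnth a i x.

Definition ball_code N a : nat :=
  pickle [seq [seq vcode (tnth a i x) | x <- tree_ball N] | i <- enum 'I_n].

Lemma ball_codeP N a b : ball_code N a = ball_code N b <-> agree N a b.
Proof.
split=> [/(pcan_inj pickleK)/eq_in_map H i x xN|ab].
  have /eq_in_map/(_ x) := H i (mem_enum _ i).
  by rewrite mem_tree_ball => /(_ xN)/vcode_inj.
congr pickle; apply: eq_map => i; apply/eq_in_map => x.
by rewrite mem_tree_ball => xN; rewrite ab.
Qed.

Definition cyl N a : set X := [set b | agree N a b].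

(** Such a set is a union of cylinders of radius [N], of which there are countably many, so
    measurability is automatic ([saturated_measurable]). *)
Definition saturated N A := forall a b, agree N a b -> A a -> A b.

Lemma agree_sym N a b : agree N a b -> agree N b a.
Proof. by move=> ab i x xN; rewrite ab. Qed.

Lemma agree_trans N a b c : agree N a b -> agree N b c -> agree N a c.
Proof. by move=> ab bc i x xN; rewrite bc // ab. Qed.

Lemma agree_le M N a b : (M <= N)%N -> agree N a b -> agree M a b.
Proof. by move=> MN ab i x xM; apply: ab; exact: leq_trans MN. Qed.

Lemma saturated_le M N A : (M <= N)%N -> saturated M A -> saturated N A.
Proof. by move=> MN sA a b /(agree_le MN); exact: sA. Qed.

Lemma saturatedI N A B : saturated N A -> saturated N B -> saturated N (A `&` B).
Proof. by move=> sA sB a b ab [/(sA _ _ ab) ? /(sB _ _ ab)]. Qed.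

Lemma saturated_cyl N a : saturated N (cyl N a).
Proof. by move=> b c bc ab; exact: agree_trans bc. Qed.

Lemma measurable_cyl N a : measurable (cyl N a).
Proof.
have -> : cyl N a = \bigcap_(i in [set: 'I_n]) ((fun b : X => tnth b i) @^-1`
    [set f : aut T | forall x, dep x <= N -> f x = tnth a i x]).
  by apply/seteqP; split=> [b ab i _|b ab i]; [exact: ab | exact: (ab i I)].
apply: fin_bigcap_measurable => [|i _]; first exact: finite_finset.
rewrite -[X in measurable X]setTI; apply: measurable_tnth => //.
exact: measurable_eq_on_ball.
Qed.

Lemma saturated_ball_code N A k : saturated N A ->
  A `&` [set a | ball_code N a = k] = set0 \/
  exists2 a, A a & A `&` [set a | ball_code N a = k] = cyl N a.
Proof.
move=> sA; have [->|/set0P[a [Aa <-]]] := eqVneq (A `&` [set a | ball_code N a = k]) set0.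
  by left.
right; exists a => //; apply/seteqP; split=> b /=.
  by move=> [_ /esym/ball_codeP].
by move=> ab; split; [exact: sA ab Aa | exact/esym/ball_codeP].
Qed.

Lemma measurable_ball_code N A k : saturated N A ->
  measurable (A `&` [set a | ball_code N a = k]).
Proof.
move=> /(@saturated_ball_code N A k)[->//|[a _ ->]]; exact: measurable_cyl.
Qed.

Lemma saturated_measurable N A : saturated N A -> measurable A.
Proof.
move=> sA; have -> : A = \bigcup_k (A `&` [set a | ball_code N a = k]).
  by apply/seteqP; split=> [a Aa|a [k _ []]] //; exists (ball_code N a).
by apply: bigcupT_measurable => k; exact: measurable_ball_code.
Qed.

Definition act (i0 : 'I_n) (h : aut T) a : X :=
  [tuple (if i == i0 then tnth a i * h else tnth a i)%g | i < n].

Lemma tnth_act i0 h a i :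
  tnth (act i0 h a) i = (if i == i0 then tnth a i * h else tnth a i)%g.
Proof. by rewrite tnth_mktuple. Qed.

Lemma actK i0 h a : act i0 h^-1%g (act i0 h a) = a.
Proof.
by apply: eq_from_tnth => i; rewrite !tnth_act; case: eqP => // _; rewrite mulgK.
Qed.

Lemma actVK i0 h a : act i0 h (act i0 h^-1%g a) = a.
Proof.
by apply: eq_from_tnth => i; rewrite !tnth_act; case: eqP => // _; rewrite mulgVK.
Qed.

Lemma act_agree i0 (h : aut T) N a b : (forall x, dep (h x) = dep x) ->
  agree N a b -> agree N (act i0 h a) (act i0 h b).
Proof.
move=> hd ab i x xN; rewrite !tnth_act; case: ifP => _; last exact: ab.
by apply: ab; rewrite hd.
Qed.

Lemma depthV (h : aut T) : (forall x, dep (h x) = dep x) ->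
  forall x, dep ((h^-1)%g x) = dep x.
Proof. by move=> hd x; rewrite -[RHS](f_equal dep (aut_invK h x)) hd. Qed.

(** * Measures of cylinders *)

Section Measure.
Local Open Scope ereal_scope.
Variables (R : realType) (mu : {measure set (aut T) -> \bar R}).
Hypothesis hmu : is_haar_measure mu.
Hypothesis hnorm : forall x : T, mu (stabilizer x) = 1%E.
Variable mun : {measure set X -> \bar R}.
Hypothesis hmun : is_product_measure mu mun.

Definition fixball N : set (aut T) :=
  [set f | forall x, (dep x <= N)%N -> f x = x].

Lemma mu_coset N (g : aut T) :
  mu [set f : aut T | forall x, (dep x <= N)%N -> f x = g x] = mu (fixball N).
Proof.
have [_ linv _ _ _] := hmu.
have mfix : measurable (fixball N) by exact: (measurable_eq_on_ball N id).
rewrite -(linv g _ mfix); congr (mu _); apply/seteqP; split=> f /=.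
  move=> fg; exists (g^-1 * f)%g; last by rewrite mulVKg.
  by move=> x xN; rewrite [LHS](_ : _ = (g^-1)%g (f x)) // fg //; exact: (aut_funK g).
by move=> [h hN <-] x xN; rewrite [LHS](_ : _ = g (h x)) // hN.
Qed.

Lemma mun_cyl N a : mun (cyl N a) = \prod_(i < n) mu (fixball N).
Proof.
rewrite -(eq_bigr _ (fun i _ => mu_coset N (tnth a i))) -hmun; last first.
  by move=> i; exact: measurable_eq_on_ball.
by congr (mun _); apply/seteqP; split=> b.
Qed.

Lemma mun_cyl0 a : mun (cyl 0 a) = 1.
Proof.
rewrite mun_cyl big1 // => i _; rewrite -(hnorm o); congr (mu _).
apply/seteqP; split=> f /= fo; first by apply: fo; rewrite leqn0 depth_eq0.
by move=> x; rewrite leqn0 depth_eq0 => /eqP ->.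
Qed.

(** Precomposition is a right translation, whereas [mu] is left-invariant. But a depth-preserving
    [h] permutes the cylinders of radius [N], and by [mun_cyl] these all have the same measure. *)
Lemma mun_act i0 (h : aut T) N A : (forall x, dep (h x) = dep x) -> saturated N A ->
  mun [set a | A (act i0 h a)] = mun A.
Proof.
move=> hd sA.
have sA' k : saturated N [set a | (A `&` [set b | ball_code N b = k]) (act i0 h a)].
  move=> a b /(act_agree i0 hd) ab /= [Aa <-].
  by split; [exact: sA ab Aa | exact/esym/ball_codeP].
rewrite (@measure_partition _ _ _ _ (ball_code N) A); last first.
  by move=> k; exact: measurable_ball_code.
rewrite (@measure_partition _ _ _ _ (fun a => ball_code N (act i0 h a))); last first.
  by move=> k; apply: saturated_measurable (sA' k).
apply: eq_eseriesr => k _.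
have -> : [set a | A (act i0 h a)] `&` [set a | ball_code N (act i0 h a) = k] =
  [set a | (A `&` [set b | ball_code N b = k]) (act i0 h a)] by [].
have [->|[a Aa ->]] := @saturated_ball_code N A k sA.
  by congr (mun _); apply/seteqP; split=> b.
have -> : [set b | cyl N a (act i0 h b)] = cyl N (act i0 (h^-1)%g a).
  apply/seteqP; split=> b /=.
    by move=> /(act_agree i0 (depthV hd)); rewrite actK.
  by move=> /(act_agree i0 hd); rewrite actVK.
by rewrite !mun_cyl.
Qed.

(** A bound that holds conditionally on the restriction to the ball is summed over the cylinders
    that make up [A]. *)
Lemma mun_le_cyl N A B1 B2 (c1 c2 : R) : saturated N A ->
  measurable B1 -> measurable B2 ->
  (forall a, A a ->
     c1%:E * mun (cyl N a `&` B1) <= c2%:E * mun (cyl N a `&` B2)) ->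
  (0 <= c1)%R ->
  c1%:E * mun (A `&` B1) <= c2%:E * mun (A `&` B2).
Proof.
move=> sA m1 m2 H c0.
have IE B k : A `&` B `&` [set a | ball_code N a = k] =
   (A `&` [set a | ball_code N a = k]) `&` B by rewrite setIAC.
rewrite (@measure_partition _ _ _ _ (ball_code N) (A `&` B1)); last first.
  by move=> k; rewrite IE; apply: measurableI => //; exact: measurable_ball_code.
rewrite (@measure_partition _ _ _ _ (ball_code N) (A `&` B2)); last first.
  by move=> k; rewrite IE; apply: measurableI => //; exact: measurable_ball_code.
rewrite -!nneseriesZl //; apply: lee_nneseries => [k _ _|k _].
  by rewrite mule_ge0 ?lee_fin.
rewrite !IE; have [->|[a Aa ->]] := @saturated_ball_code N A k sA; last exact: H.
by rewrite !set0I measure0 !mule0.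
Qed.

End Measure.
End Cylinders.

(** * Counting inequalities for finite families of sets *)

Section FiniteFamilies.
Local Open Scope ereal_scope.
Variables (d : measure_display) (X : measurableType d) (R : realType).
Variable m : {measure set X -> \bar R}.

Lemma measure_split (A B : set X) : measurable A -> measurable B ->
  m A = m (A `&` B) + m (A `&` ~` B).
Proof.
move=> mA mB; rewrite -measureU.
- by rewrite -setIUr setUv setIT.
- exact: measurableI.
- by apply: measurableI => //; exact: measurableC.
- by rewrite setIACA setICr setI0.
Qed.

(** Integration of the counting function, by induction on [s]: split [A] along the first set, inside
    which [K.-1] of the others suffice. It yields Markov's inequality, and the union bound for
    [K = 1]. *)
Lemma measure_count (I : eqType) (s : seq I) (F : I -> set X) (A : set X) K :
  (forall i, measurable (F i)) -> measurable A ->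
  (forall a, A a -> (K <= count (fun i => `[< F i a >]) s)%N) ->
  K%:R%:E * m A <= \sum_(i <- s) m (A `&` F i).
Proof.
move=> mF; elim: s A K => [|i s IH] A K mA H.
  rewrite big_nil; case: K H => [|K] H; first by rewrite mul0e.
  suff -> : A = set0 by rewrite measure0 mule0.
  by apply/seteqP; split=> a // /H.
have mAF : measurable (A `&` F i) by exact: measurableI.
have mAC : measurable (A `&` ~` F i).
  by apply: measurableI => //; exact: measurableC.
have [->|K0] := posnP K; first by rewrite mul0e sume_ge0.
have IH1 := IH (A `&` F i) K.-1 mAF.
have IH2 := IH (A `&` ~` F i) K mAC.
have {}IH1 : K.-1%:R%:E * m (A `&` F i) <= \sum_(j <- s) m (A `&` F i `&` F j).
  apply: IH1 => a [/H /= Ha Fa]; move: Ha; rewrite asboolT //; lia.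
have {}IH2 : K%:R%:E * m (A `&` ~` F i) <= \sum_(j <- s) m (A `&` ~` F i `&` F j).
  by apply: IH2 => a [/H /= Ha Fa]; move: Ha; rewrite asboolF.
rewrite big_cons (measure_split mA (mF i)) ge0_muleDr //.
have -> : \sum_(j <- s) m (A `&` F j) =
    \sum_(j <- s) m (A `&` F i `&` F j) + \sum_(j <- s) m (A `&` ~` F i `&` F j).
  rewrite -big_split /=; apply: eq_bigr => j _.
  rewrite (measure_split (measurableI _ _ mA (mF j)) (mF i)).
  by rewrite setIAC [X in _ + m X]setIAC.
have -> : K%:R%:E * m (A `&` F i) = m (A `&` F i) + K.-1%:R%:E * m (A `&` F i).
  rewrite -{2}[m (A `&` F i)]mul1e -ge0_muleDl ?lee_fin ?ler0n //.
  by rewrite -EFinD addrC natr1 prednK.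
by rewrite -addeA leeD2l // leeD.
Qed.

Lemma sum_measure_disjoint (I : eqType) (s : seq I) (F : I -> set X) (A : set X) :
  (forall i, measurable (F i)) -> measurable A -> uniq s ->
  (forall i j a, F i a -> F j a -> i = j) ->
  (forall i, i \in s -> F i `<=` A) ->
  \sum_(i <- s) m (F i) <= m A.
Proof.
move=> mF + + disj; elim: s A => [|i s IH] A mA; first by rewrite big_nil.
rewrite cons_uniq => /andP[iNs us] sub.
rewrite big_cons (measure_split mA (mF i)) leeD //.
  rewrite le_measure ?inE //; first exact: measurableI.
  by move=> a Fa; split=> //; apply: sub Fa; rewrite inE eqxx.
apply: IH => //; first by apply: measurableI => //; exact: measurableC.
move=> j js a Fja; split; first by apply: sub Fja; rewrite inE js orbT.
by move=> Fia; move: iNs; rewrite (disj _ _ _ Fia Fja) js.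
Qed.

End FiniteFamilies.

(** * Extinction *)

Section Survival.
Variables (T : graph) (e n : nat) (r : rooting T e.+2).
Local Notation o := (origin r).
Local Notation dep := (depth r).
Local Notation par := (parent r).
Local Notation ch := (children r).
Local Notation X := (n.-tuple (aut T)).
Implicit Types (a b : X).
Variables (w' : word n) (g : 'I_n) (u0 : T) (k0 : nat).
Local Notation w := (rcons w' (g, false)).
Local Notation desc := (desc r).
Local Notation lev m := (dep u0 + m).

(* Since the last letter of [w] is the generator [g], the last edge of the
   trajectory of [u0] is [(g, u0)]; it is used only once and has maximal
   depth. *)
Definition base_loop a : Prop := [/\ ev (tnth a) w u0 = u0,
  uniq (edges (tnth a) w u0),
  all (fun v => dep v.2 <= dep u0) (edges (tnth a) w u0),
  parent_compat r (tnth a) w u0 & ball_code r 0 a = k0].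

Definition survives : set X := [set a | base_loop a /\
  forall m, exists2 u, u \in desc m u0 & ev (tnth a) w u = u].

Lemma ev_last (f : 'I_n -> aut T) x :
  ev f w x = ev f w' (f g x).
Proof. by rewrite -cats1 ev_cat. Qed.

Lemma edges_last (f : 'I_n -> aut T) x :
  edges f w x = rcons (edges f w' (f g x)) (g, x).
Proof. by rewrite -!cats1 edges_cat. Qed.

(** For the last clause: a later use of [g] at a vertex of generation [m] would project to a second
    occurrence of the edge [(g, u0)] in the base trajectory, whose edges are distinct. *)
Lemma base_desc a m u : base_loop a -> u \in desc m u0 ->
  [/\ parent_compat r (tnth a) w u,
      {in edges (tnth a) w u, forall v, dep v.2 <= lev m},
      ev (tnth a) w u \in desc m u0 &
      forall v, v \in edges (tnth a) w' (tnth a g u) -> v.1 = g ->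
        v.2 \notin desc m u0].
Proof.
move=> [wu0 un /allP dl pu _] um.
have [pcu evu du mu] := compat_desc pu um.
split=> //.
- move=> v vu; rewrite (du _ vu) leq_add2r.
  have /dl : (v.1, iter m par v.2) \in edges (tnth a) w u0.
    by rewrite -mu; apply/mapP; exists v.
  by [].
- by rewrite wu0 in evu.
- move=> v vu v1; apply/negP => v2; move: un; rewrite -mu edges_last.
  rewrite map_rcons rcons_uniq => /andP[/negP H _]; apply: H.
  apply/mapP; exists v => //; rewrite v1 /=; congr pair.
  by move: v2 um; rewrite !mem_desc => /andP[/eqP -> _] /andP[/eqP -> _].
Qed.

(** All edges of the base trajectory, and their parents, lie at depth at most that of [u0]. *)
Lemma base_agree a b : agree r (dep u0) a b -> base_loop a -> base_loop b.
Proof.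
move=> ab [wu0 un /allP dl pu ka].
have H v : v \in edges (tnth a) w u0 -> tnth b v.1 v.2 = tnth a v.1 v.2.
  by move=> /dl; exact: ab.
have [evb edb] := ev_agree H.
split; rewrite ?evb ?edb //; first by apply/allP.
  apply: compat_agree pu => v vu; split; first exact: H.
  apply: ab; apply: leq_trans (dl _ vu).
  have [->|vo] := eqVneq v.2 o; first by rewrite parent_origin.
  by rewrite (depth_parent vo).
rewrite -ka; apply/ball_codeP; apply: agree_sym; exact: agree_le ab.
Qed.

Lemma base_ev a b m u : base_loop a -> u \in desc m u0 ->
  agree r (lev m) a b -> ev (tnth b) w u = ev (tnth a) w u.
Proof.
move=> ba um ab; have [_ dl _ _] := base_desc ba um.
have [//|-> //] := @ev_agree _ _ (tnth a) (tnth b) w u.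
by move=> v /dl; exact: ab.
Qed.

Lemma base_agree_lev m a b :
  agree r (lev m) a b -> base_loop a -> base_loop b.
Proof. by move/(agree_le (leq_addr m _)); exact: base_agree. Qed.

(** * Permuting the children of one generation *)

Section Perturbation.
Variables (m : nat) (s : T -> {perm 'I_e.+2}).
Hypothesis sdesc : forall p, p \notin desc m u0 -> s p = 1%g.
Local Notation h := (portrait r s).

Lemma perturb_id x : dep x <= lev m -> h x = x.
Proof.
move=> xm; apply: portrait_id => p px; apply: sdesc; apply/negP.
by move/depth_desc => pe; move: px; rewrite pe; lia.
Qed.

Lemma perturb_agree a : agree r (lev m) a (act g h a).
Proof.
move=> i x xm; rewrite tnth_act; case: eqP => // _.
by rewrite [LHS](_ : _ = tnth a i (h x)) // perturb_id.
Qed.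

Lemma perturb_child u y : u \in desc m u0 -> u != o -> y \in ch u ->
  h y = child r u (s u (label r y)).
Proof.
move=> um uo yu; apply: portrait_child => //.
by apply: perturb_id; rewrite (depth_desc um).
Qed.

(** Only the first step notices [h]. A later use of [g] happens at a vertex whose parent is, by
    [base_desc], outside generation [m] and not deeper than it; there [h] is the identity. *)
Lemma perturb_ev a u y : base_loop a -> u \in desc m u0 -> y \in ch u ->
  ev (tnth (act g h a)) w y = ev (tnth a) w (h y).
Proof.
move=> ba um yu; have [pu dl _ avoid] := base_desc ba um.
have uo : u != o.
  by move: pu; rewrite -cats1 compat_cat => /andP[/=/and3P[]].
rewrite !ev_last tnth_act eqxx [X in ev _ w' X](_ : _ = tnth a g (h y)) //.
have hyu : h y \in ch u by rewrite (perturb_child um) // mem_child.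
have [_ _ ay my] := compat_child pu hyu.
move: my ay; rewrite !edges_last map_rcons => /rcons_inj[my _].
rewrite all_rcons => /andP[_ /allP ay].
have [//|-> //] := @ev_agree _ _ (tnth a) (tnth (act g h a)) w' (tnth a g (h y)).
move=> v vy; rewrite tnth_act; case: eqP => // vg.
rewrite [LHS](_ : _ = tnth a v.1 (h v.2)) //; congr (tnth a _ _).
have pv : (v.1, par v.2) \in edges (tnth a) w' (tnth a g u).
  by rewrite -my; apply/mapP; exists v.
apply: portrait_par_id; last by apply: sdesc; apply: avoid pv vg.
apply: perturb_id; apply: (dl (v.1, par v.2)).
by rewrite edges_last mem_rcons inE pv orbT.
Qed.

End Perturbation.

Definition fixes u : set X := [set a | base_loop a /\ ev (tnth a) w u = u].

Definition dead m : set X := [set a | base_loop a /\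
  forall u, u \in desc m u0 -> ev (tnth a) w u != u].

Definition alive m : set X := [set a | base_loop a /\
  exists2 u, u \in desc m u0 & ev (tnth a) w u = u].

Definition fixed_desc m a := [seq u <- desc m u0 | ev (tnth a) w u == u].

Lemma saturated_fixes m u : u \in desc m u0 -> saturated r (lev m) (fixes u).
Proof.
move=> um a b ab [ba wu]; split; first exact: base_agree_lev ab ba.
by rewrite (base_ev ba um ab).
Qed.

Lemma saturated_dead m : saturated r (lev m) (dead m).
Proof.
move=> a b ab [ba du]; split; first exact: base_agree_lev ab ba.
by move=> u um; rewrite (base_ev ba um ab) du.
Qed.

Lemma saturated_alive m : saturated r (lev m) (alive m).
Proof.
move=> a b ab [ba [u um wu]]; split; first exact: base_agree_lev ab ba.
by exists u => //; rewrite (base_ev ba um ab).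
Qed.

Lemma fixed_desc_agree m a b : base_loop a -> agree r (lev m) a b ->
  fixed_desc m b = fixed_desc m a.
Proof.
by move=> ba ab; apply: eq_in_filter => u um; rewrite (base_ev ba um ab).
Qed.

Lemma base_par a m y : base_loop a -> y \in desc m.+1 u0 ->
  ev (tnth a) w y = y -> ev (tnth a) w (par y) = par y.
Proof.
by move=> ba /(base_desc ba)[py _ _ _] wy; rewrite -(compat_parent py) wy.
Qed.

Lemma fixes_par m y : y \in desc m.+1 u0 -> fixes y `<=` fixes (par y).
Proof. by move=> ym a [ba wy]; split=> //; exact: (base_par ba ym wy). Qed.

Lemma base_neq a m u : base_loop a -> u \in desc m u0 -> u != o.
Proof.
move=> ba /(base_desc ba)[pu _ _ _].
by move: pu; rewrite -cats1 compat_cat => /andP[/=/and3P[]].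
Qed.

(** Distinct translations of the cyclic group of labels disagree at every label, and translation by
    1 fixes none because there are at least two labels. *)
Definition rotation (i : 'I_e.+2) : {perm 'I_e.+2} := perm (addrI i).

(** If [f] is the permutation of labels that [w] induces on the children of [u], choose [t] so that
    [f] after [t] is the rotation by 1. *)
Lemma fixpoint_free_perturbation a m u : base_loop a -> u \in desc m u0 ->
  ev (tnth a) w u = u -> exists t : {perm 'I_e.+2},
    forall j, ev (tnth a) w (child r u (t j)) != child r u j.
Proof.
move=> ba um wu; have uo := base_neq ba um; have [pu _ _ _] := base_desc ba um.
have mem_ch j : ev (tnth a) w (child r u j) \in ch u.
  by have [_ + _ _] := compat_child pu (mem_child j uo); rewrite wu.
pose f j := label r (ev (tnth a) w (child r u j)).
have fE j : child r u (f j) = ev (tnth a) w (child r u j) by rewrite labelK.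
have f_inj : injective f.
  by move=> i j /(congr1 (child r u)); rewrite !fE => /ev_inj/(child_inj uo).
exists (rotation 1%R * (perm f_inj)^-1)%g => j; rewrite permM -fE.
have -> : f ((perm f_inj)^-1%g (rotation 1%R j)) = rotation 1%R j.
  by rewrite -[LHS](permE f_inj) permKV.
rewrite permE.
apply/eqP => /(child_inj uo)/eqP.
by rewrite -subr_eq0 addrK oner_eq0.
Qed.

(** * The critical branching estimate *)

Section Measure.
Local Open Scope ereal_scope.
Variables (R : realType) (mu : {measure set (aut T) -> \bar R}).
Hypothesis hmu : is_haar_measure mu.
Hypothesis hnorm : forall x : T, mu (stabilizer x) = 1%E.
Variable mun : {measure set X -> \bar R}.
Hypothesis hmun : is_product_measure mu mun.

(** Rotate the children of [u] in all [e.+2] ways. The events that the rotated tuple fixes [y] have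
    equal measure and lie in the cylinder. They are disjoint: [w] is injective, so only one rotated
    position of [y] can be mapped to [y]. *)
Lemma cyl_fixes_child a m u y : base_loop a -> u \in desc m u0 ->
  y \in ch u ->
  e.+2%:R%:E * mun (cyl r (lev m) a `&` fixes y) <= mun (cyl r (lev m) a).
Proof.
move=> ba um yu; have uo := base_neq ba um.
have ym : y \in desc m.+1 u0.
  by rewrite mem_descS; have /mem_childrenP[-> ->] := yu.
pose s i p := if p == u then rotation i else 1%g.
have sE i p : p \notin desc m u0 -> s i p = 1%g.
  by rewrite /s; case: eqP => // ->; rewrite um.
pose A := cyl r (lev m) a `&` fixes y.
have sA : saturated r (lev m.+1) A.
  apply: saturatedI; last exact: saturated_fixes.
  by apply: (@saturated_le _ _ _ r (lev m)); [rewrite leq_add2l | exact: saturated_cyl].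
pose F i := [set b | A (act g (portrait r (s i)) b)].
have mF i : mun (F i) = mun A.
  exact: (mun_act hmu hmun g (@portrait_depth _ _ r (s i)) sA).
have -> : e.+2%:R%:E * mun A = \sum_(i <- enum 'I_e.+2) mun (F i).
  under eq_bigr do rewrite mF.
  by rewrite big_const_seq count_predT size_enum_ord iter_addr addr0 mule_natl.
have Fcyl i b : F i b -> cyl r (lev m) a b.
  move=> [cb _]; apply: agree_trans cb _; apply: agree_sym.
  exact: perturb_agree (sE i) b.
apply: sum_measure_disjoint => //.
- move=> i; apply: (@saturated_measurable _ _ _ r (lev m.+1)) => b c bc.
  by apply: sA; apply: act_agree bc; exact: portrait_depth.
- exact: measurable_cyl.
- exact: enum_uniq.
- move=> i j b Fi Fj; have bb : base_loop b by apply: base_agree_lev ba; exact: Fcyl Fi.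
  have [_ [_]] := Fi; rewrite (perturb_ev (sE i) bb um yu) => wi.
  have [_ [_]] := Fj; rewrite (perturb_ev (sE j) bb um yu) => wj.
  have := ev_inj (etrans wi (esym wj)).
  rewrite (perturb_child (sE i) um uo yu) (perturb_child (sE j) um uo yu).
  by move/(child_inj uo); rewrite /s eqxx !permE => /addIr.
- by move=> i _ b; exact: Fcyl.
Qed.

(** The last clause of [base_loop] serves this bound: it confines base loops to a single cylinder of
    radius 0, which has measure 1. *)
Lemma mun_base_le1 A : measurable A -> A `<=` [set a | base_loop a] ->
  mun A <= 1.
Proof.
move=> mA sub; have [->|/set0P[a Aa]] := eqVneq A set0.
  by rewrite measure0.
rewrite -(mun_cyl0 r hmu hnorm hmun a); apply: le_measure; rewrite ?inE //.
  exact: measurable_cyl.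
move=> b /sub[_ _ _ _ kb]; have [_ _ _ _ ka] := sub _ Aa.
by apply/ball_codeP; rewrite ka.
Qed.

Lemma measurable_fixes m u : u \in desc m u0 -> measurable (fixes u).
Proof. by move=> um; apply: saturated_measurable; exact: saturated_fixes um. Qed.

Lemma mun_fixes_child m u y : u \in desc m u0 -> y \in ch u ->
  e.+2%:R%:E * mun (fixes y) <= mun (fixes u).
Proof.
move=> um yu; have ym : y \in desc m.+1 u0.
  by rewrite mem_descS; have /mem_childrenP[-> ->] := yu.
have yp : par y = u by have /mem_childrenP[] := yu.
have := @mun_le_cyl _ _ _ r _ mun (lev m) (fixes u) (fixes y) setT e.+2%:R 1.
rewrite setIT mul1e setIidr; last by rewrite -yp; exact: fixes_par ym.
apply; rewrite ?ler0n //.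
- exact: saturated_fixes.
- exact: measurable_fixes ym.
- by move=> a [ba _]; rewrite setIT mul1e; exact: (cyl_fixes_child ba um yu).
Qed.

Lemma sum_mun_fixes_children m u : u \in desc m u0 ->
  \sum_(y <- ch u) mun (fixes y) <= mun (fixes u).
Proof.
(* The number of children is known only away from the origin. A member of [fixes u] shows that [u]
   is not the origin; without one, the events for the children are empty too. *)
move=> um; have [f0|/set0P[a [ba _]]] := eqVneq (fixes u) set0.
  rewrite big_seq big1 // => y yu; apply/eqP; rewrite -measure_le0.
  have ym : y \in desc m.+1 u0.
    by rewrite mem_descS; have /mem_childrenP[-> ->] := yu.
  have yp : par y = u by have /mem_childrenP[] := yu.
  have : fixes y `<=` set0 by rewrite -f0 -yp; exact: fixes_par ym.
  by rewrite subset0 => ->; rewrite measure0.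
have uo := base_neq ba um.
have fin : mun (fixes u) \is a fin_num.
  rewrite ge0_fin_numE //; apply: le_lt_trans (ltry 1).
  by apply: mun_base_le1 => [|b []//]; exact: measurable_fixes um.
have E := fineK fin; set c := fine _ in E; rewrite -E.
have H y : y \in ch u -> mun (fixes y) <= (c / e.+2%:R)%:E.
  move=> yu; rewrite EFinM muleC lee_pdivlMl ?ltr0n // E.
  exact: mun_fixes_child um yu.
apply: (@le_trans _ _ (\sum_(y <- ch u) (c / e.+2%:R)%:E)).
  by rewrite big_seq [leRHS]big_seq; apply: lee_sum.
rewrite sumEFin big_const_seq count_predT size_children // iter_addr addr0.
by rewrite -[X in X%:E]mulr_natr divfK ?pnatr_eq0.
Qed.

(** The sum is the expected number of fixed descendants in generation [m], which does not increase
    with [m]. *)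
Lemma sum_mun_fixes m : \sum_(u <- desc m u0) mun (fixes u) <= 1.
Proof.
elim: m => [|m IH].
  rewrite big_seq1; apply: mun_base_le1 => [|a []//].
  by apply: (@measurable_fixes 0); rewrite mem_seq1.
apply: le_trans IH; rewrite big_flatten big_map /=.
rewrite big_seq [leRHS]big_seq; apply: lee_sum => u um.
exact: sum_mun_fixes_children um.
Qed.

Lemma saturated_count m (P : pred nat) :
  saturated r (lev m) [set a | base_loop a /\ P (size (fixed_desc m a))].
Proof.
move=> a b ab [ba Pa]; split; first exact: base_agree_lev ab ba.
by rewrite (fixed_desc_agree ba ab).
Qed.

Lemma mun_many_fixed m K :
  K%:R%:E * mun [set a | base_loop a /\ (K <= size (fixed_desc m a))%N] <= 1.
Proof.
set A := mkset _; have mA : measurable A.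
  apply: (@saturated_measurable _ _ _ r (lev m)).
  exact: (@saturated_count m (leq K)).
apply: (le_trans _ (sum_mun_fixes m)).
(* [measure_count] wants measurability at every index, hence the empty set outside generation
   [m]. *)
pose F u := if u \in desc m u0 then fixes u else set0.
have mF u : measurable (F u).
  by rewrite /F; case: ifP => // um; exact: measurable_fixes um.
apply: (@le_trans _ _ (\sum_(u <- desc m u0) mun (A `&` F u))).
  apply: measure_count => // a [ba]; rewrite size_filter => Ka.
  apply: leq_trans Ka _; rewrite leq_eqVlt; apply/orP; left; apply/eqP.
  apply: eq_in_count => u um; rewrite /F um.
  by apply/eqP/asboolP => [|[]//].
rewrite big_seq [leRHS]big_seq; apply: lee_sum => u um; rewrite /F um.
by apply: le_measure; rewrite ?inE //; [apply: measurableI => // | ];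
  exact: measurable_fixes um.
Qed.

(** Indexing the permutations by positions in [S] below [K], rather than by vertices, makes the
    number of choices depend on [K] alone. *)
Definition portrait_of (S : seq T) K (t : {ffun 'I_K -> {perm 'I_e.+2}}) p :
    {perm 'I_e.+2} :=
  if p \in S then oapp t 1%g (insub (index p S)) else 1%g.

Definition kill_cost K : R := #|{ffun 'I_K -> {perm 'I_e.+2}}|%:R%R.

(** For each tuple of the cylinder, some choice of permutations at the fixed vertices leaves no
    fixed child. So the cylinder is covered by the preimages of the dead part under [kill_cost K]
    perturbations, each preserving its measure. *)
Lemma cyl_dead a m K : base_loop a -> (size (fixed_desc m a) <= K)%N ->
  mun (cyl r (lev m) a) <=
  (kill_cost K)%:E * mun (cyl r (lev m) a `&` dead m.+1).
Proof.
move=> ba SK; set S := fixed_desc m a in SK.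
have SP u : (u \in S) = (u \in desc m u0) && (ev (tnth a) w u == u).
  by rewrite mem_filter andbC.
pose s := @portrait_of S K.
have sE t p : p \notin desc m u0 -> s t p = 1%g.
  by rewrite /s /portrait_of SP; case: (p \in desc m u0).
pose A := cyl r (lev m) a `&` dead m.+1.
have sA : saturated r (lev m.+1) A.
  apply: saturatedI; last exact: saturated_dead.
  by apply: (@saturated_le _ _ _ r (lev m)); [rewrite leq_add2l | exact: saturated_cyl].
pose F t := [set b | A (act g (portrait r (s t)) b)].
have mF t : mun (F t) = mun A.
  exact: (mun_act hmu hmun g (@portrait_depth _ _ r (s t)) sA).
have meF t : measurable (F t).
  apply: (@saturated_measurable _ _ _ r (lev m.+1)) => b c bc.
  by apply: sA; apply: act_agree bc; exact: portrait_depth.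
have -> : (kill_cost K)%:E * mun A =
    \sum_(t <- enum {ffun 'I_K -> {perm 'I_e.+2}}) mun (F t).
  under eq_bigr do rewrite mF.
  by rewrite big_const_seq count_predT -cardE iter_addr addr0 mule_natl.
rewrite -[leLHS]mul1e; apply: le_trans.
  apply: (@measure_count _ _ _ mun _ (enum {ffun 'I_K -> {perm 'I_e.+2}}) F _ 1) => //.
    exact: measurable_cyl.
  move=> b ab; have bb : base_loop b by exact: base_agree_lev ab ba.
  have wb u : u \in desc m u0 -> ev (tnth b) w u = ev (tnth a) w u.
    by move=> um; exact: base_ev ab.
  have /fin_all_exists[t0 t0P] (i : 'I_K) : exists t : {perm 'I_e.+2},
      (i < size S)%N -> forall j,
      ev (tnth b) w (child r (nth o S i) (t j)) != child r (nth o S i) j.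
    have [iS|_] := boolP (i < size S)%N; last by exists 1%g.
    have := mem_nth o iS; rewrite SP => /andP[um /eqP wu].
    have [|t tP] := @fixpoint_free_perturbation b m (nth o S i) bb um.
      by rewrite wb.
    by exists t.
  rewrite -has_count; apply/hasP; exists (finfun t0); first by rewrite mem_enum.
  apply/asboolP; rewrite /F /=.
  have ab' := agree_trans ab (perturb_agree (sE (finfun t0)) b).
  have bb' := base_agree_lev ab' ba.
  split=> //; split=> // y ym; apply/eqP => wy.
  have /andP[yo pym] : (y != o) && (par y \in desc m u0) by rewrite -mem_descS.
  have ypy : y \in ch (par y) by rewrite mem_children yo eqxx.
  have pyo := base_neq ba pym.
  have pyS : par y \in S.
    by rewrite SP pym -(base_ev ba pym ab') (base_par bb' ym wy) eqxx.
  have iS : (index (par y) S < size S)%N by rewrite index_mem.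
  have iK : (index (par y) S < K)%N by exact: leq_trans iS SK.
  move: wy; rewrite (perturb_ev (sE _) bb pym ypy).
  rewrite (perturb_child (sE _) pym pyo ypy) /s /portrait_of pyS.
  rewrite insubT /= ffunE.
  have := t0P (Ordinal iK) iS (label r y); rewrite /= nth_index //.
  by rewrite labelK // => /eqP.
apply: lee_sum => t _; apply: le_measure; rewrite ?inE //.
by apply: measurableI => //; exact: measurable_cyl.
Qed.

(** By [cyl_dead], a proportion of at least the inverse of [kill_cost K] of the left-hand event dies
    in the next generation, and what dies lies in [alive m] minus [alive m.+1]. *)
Lemma alive_decr m K :
  mun [set a | base_loop a /\ (0 < size (fixed_desc m a) <= K)%N] <=
  (kill_cost K)%:E * (mun (alive m) - mun (alive m.+1)).
Proof.
set A := mkset _.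
have sA : saturated r (lev m) A.
  exact: (@saturated_count m (fun s => 0 < s <= K)%N).
have mal k : measurable (alive k).
  by apply: saturated_measurable; exact: saturated_alive.
have md k : measurable (dead k).
  by apply: saturated_measurable; exact: saturated_dead.
have := @mun_le_cyl _ _ _ r _ mun (lev m) A setT (dead m.+1) 1 (kill_cost K).
rewrite setIT mul1e => H; apply: le_trans.
  apply: H => // a [ba /andP[_ aK]]; rewrite mul1e setIT; exact: cyl_dead.
have sub : alive m.+1 `<=` alive m.
  move=> a [ba [y ym wy]]; split=> //; exists (par y).
    by move: ym; rewrite mem_descS => /andP[].
  exact: base_par ym wy.
have -> : mun (alive m) - mun (alive m.+1) = mun (alive m `\` alive m.+1).
  rewrite measureD ?(setIidr sub) //.
  by apply: le_lt_trans (ltry 1); apply: mun_base_le1 => // a [].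
rewrite lee_wpmul2l ?lee_fin ?ler0n //; apply: le_measure; rewrite ?inE //.
- by apply: measurableI => //; exact: saturated_measurable sA.
- exact: measurableD.
- move=> a [[ba /andP[S0 _]] [_ da]]; split.
    split=> //; move: S0; rewrite -has_predT => /hasP[u].
    by rewrite mem_filter => /andP[/eqP wu um] _; exists u.
  by move=> [_ [u um wu]]; have := da _ um; rewrite wu eqxx.
Qed.

Lemma survives_null : mun.-negligible survives.
Proof.
pose V := \bigcap_m alive m.
have mal k : measurable (alive k).
  by apply: saturated_measurable; exact: saturated_alive.
have mV : measurable V by apply: bigcapT_measurable.
exists V; split=> //; last by move=> a [ba sa] m _; split.
have fin A : measurable A -> A `<=` [set a | base_loop a] -> mun A \is a fin_num.
  move=> mA sA; rewrite ge0_fin_numE //; apply: le_lt_trans (ltry 1).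
  exact: mun_base_le1.
have fal m : mun (alive m) \is a fin_num by apply: fin => // a [].
have fV : mun V \is a fin_num by apply: fin => // a /(_ 0%N I)[].
pose p m := fine (mun (alive m)); pose v := fine (mun V).
have pE m : mun (alive m) = (p m)%:E by rewrite fineK.
have vE : mun V = v%:E by rewrite fineK.
have vp m : (v <= p m)%R.
  rewrite -lee_fin -vE -pE; apply: le_measure; rewrite ?inE //.
  by move=> a /(_ m I).
have p0 m : (0 <= p m)%R by rewrite fine_ge0.
have p1 : (p 0%N <= 1)%R.
  by rewrite -lee_fin -pE; apply: mun_base_le1 => // a [].
(* Markov's inequality bounds the part with more than [K] fixed descendants,
   the drop of [p] bounds the rest; the drops telescope. *)
have step m K : (K.+1%:R * p m <= 1 + K.+1%:R * (kill_cost K * (p m - p m.+1)))%R.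
  have := mun_many_fixed m K.+1; have := alive_decr m K.
  set A := mkset _; set B := mkset _ => HA HB.
  have mA : measurable A.
    apply: (@saturated_measurable _ _ _ r (lev m)).
    exact: (@saturated_count m (fun s => 0 < s <= K)%N).
  have mB : measurable B.
    apply: (@saturated_measurable _ _ _ r (lev m)).
    exact: (@saturated_count m (leq K.+1)).
  have fA : mun A \is a fin_num by apply: fin => // a [].
  have fB : mun B \is a fin_num by apply: fin => // a [].
  move: HA HB; rewrite !pE -(fineK fA) -(fineK fB) -EFinB -!EFinM !lee_fin.
  set x := fine (mun A); set y := fine (mun B) => HA HB.
  have pxy : (p m <= x + y)%R.
    rewrite -lee_fin -pE EFinD /x /y !fineK //.
    apply: le_trans (measureU2 _ _ _) => //; apply: le_measure; rewrite ?inE //.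
      exact: measurableU.
    move=> a [ba [u um wu]]; have [le|lt] := leqP (size (fixed_desc m a)) K.
      left; split=> //; rewrite le andbT -has_predT; apply/hasP; exists u => //.
      by rewrite mem_filter um wu eqxx.
    by right.
  apply: (@le_trans _ _ (K.+1%:R * (x + y))%R); first by rewrite ler_wpM2l.
  by rewrite mulrDr addrC lerD // ler_wpM2l.
have sumstep M K : (M%:R * (K.+1%:R * v) <=
    M%:R + K.+1%:R * (kill_cost K * (p 0%N - p M)))%R.
  elim: M => [|M IH]; first by rewrite !mul0r subrr !mulr0 addr0.
  have := step M K; have := vp M => H1 H2.
  have H3 : (K.+1%:R * v <= K.+1%:R * p M)%R by rewrite ler_wpM2l.
  have H4 := le_trans H3 H2.
  rewrite -natr1 mulrDl mul1r (le_trans (lerD IH H4)) // le_eqVlt.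
  by apply/orP; left; apply/eqP; ring.
have v0 : (0 <= v)%R by rewrite fine_ge0.
rewrite vE; congr EFin; apply/eqP; rewrite eq_le v0 andbT leNgt; apply/negP => vpos.
(* If [v] is positive, this [K] makes the left side of each step exceed 2 against the constant 1 on
   the right. After [M] steps the excess is at least [M], while the total drop accounts for at most
   [C]; any [M] above [C] is a contradiction. *)
have [K HK] : exists K : nat, (2 < K.+1%:R * v)%R.
  exists (Num.truncn (2 / v)); rewrite -ltr_pdivrMr //.
  exact: truncnS_gt.
pose C := (K.+1%:R * kill_cost K)%R.
have C0 : (0 <= C)%R by rewrite mulr_ge0.
pose M := (Num.truncn C).+1.
have CM : (C < M%:R)%R by exact: truncnS_gt.
have := sumstep M K.
have : (M%:R * 2 <= M%:R * (K.+1%:R * v))%R by rewrite ler_wpM2l // ltW.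
have : (K.+1%:R * (kill_cost K * (p 0%N - p M)) <= C)%R.
  rewrite mulrA -/C ler_piMr //.
  by rewrite (le_trans _ p1) // gerBl.
lra.
Qed.

End Measure.
End Survival.

(** * Words with infinitely many fixed vertices *)

Section Loops.
Variables (T : graph) (d n : nat) (r : rooting T d) (f : 'I_n -> aut T).
Local Notation o := (origin r).
Local Notation dep := (depth r).
Local Notation par := (parent r).
Local Notation ch := (children r).
Local Notation desc := (desc r).
Implicit Types (w : word n) (x u : T) (l : 'I_n * bool).

Definition fixed_vertices w : set T := [set u | ev f w u = u].

Lemma finite_depth (S : set T) : finite_set S ->
  exists N, forall u, S u -> dep u < N.
Proof.
move=> /finite_seqP[s ->]; elim: s => [|x s [N HN]]; first by exists 0.
exists (maxn N (dep x).+1) => u /=; rewrite inE => /orP[/eqP->|/HN].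
  by rewrite leq_max ltnS leqnn orbT.
by rewrite leq_max => ->.
Qed.

Lemma finite_ball N : finite_set [set u | dep u <= N].
Proof.
apply/finite_seqP; exists (tree_ball r N); apply/seteqP.
by split=> u /=; rewrite mem_tree_ball.
Qed.

Lemma finite_preimage_ev w (S : set T) : finite_set S ->
  finite_set [set u | S (ev f w u)].
Proof.
move=> fS; apply: sub_finite_set (finite_image (ev f (winv w)) fS).
by move=> u Su; exists (ev f w u) => //; exact: ev_winv.
Qed.

Lemma deep_ev w D : exists N, forall u, N <= dep u -> D <= dep (ev f w u).
Proof.
have [N HN] := finite_depth (finite_preimage_ev w (finite_ball D)).
exists N => u; apply: contraTT; rewrite -!ltnNge => lt.
by apply: HN; exact: ltnW.
Qed.

(* Along the geodesic from [x] to the root an automorphism either preserves the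
   direction at [x] or reverses it on the whole geodesic, and then it moves the
   root at least as far as [x] is deep. *)
Lemma reversed_depth l x : x != o -> lact f l (par x) != o ->
  par (lact f l (par x)) = lact f l x ->
  dep x + dep (lact f l x) <= dep (lact f l o).
Proof.
move: {2}(dep x) (erefl (dep x)) => m; elim: m x => [|m IH] x dx xo pxo rev.
  by move: xo; rewrite -(depth_eq0 r) dx.
have dpx : dep (par x) = m by move: (depth_parent xo); rewrite dx => -[].
have dlp : dep (lact f l (par x)) = (dep (lact f l x)).+1.
  by rewrite (depth_parent pxo) rev.
have [po|po] := eqVneq (par x) o.
  have /eqP o0 : dep o == 0 by rewrite depth_eq0.
  by rewrite -[in leqRHS]po dlp (depth_parent xo) po o0.
have ppx : lact f l (par (par x)) != lact f l x.
  rewrite (inj_eq (@lact_inj _ _ f l)); apply/eqP => e.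
  by have := depth_parent po; rewrite e (depth_parent xo); lia.
have : adj (lact f l (par x)) (lact f l (par (par x))).
  by rewrite lact_adj (adjE r) po eqxx.
rewrite (adjE r) rev [lact f l x == _]eq_sym (negbTE ppx) andbF /= => /andP[ppo /eqP rev'].
have := IH _ dpx po ppo rev'; rewrite dlp dx dpx; lia.
Qed.

Lemma deep_parent l : exists N, forall x, N <= dep x ->
  lact f l x != o /\ par (lact f l x) = lact f l (par x).
Proof.
have [N HN] := deep_ev [:: l] 1.
(* The first bound keeps the image off the origin; the second contradicts [reversed_depth]. *)
exists (maxn N (dep (lact f l o)).+1) => x; rewrite geq_max => /andP[/HN d1 d2].
have lxo : lact f l x != o by rewrite -(depth_eq0 r) -lt0n.
have xo : x != o by rewrite -(depth_eq0 r) -lt0n; lia.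
split=> //; apply/eqP/contraT => ne.
have : adj (lact f l x) (lact f l (par x)).
  by rewrite lact_adj (adjE r) xo eqxx.
rewrite (adjE r) (negbTE ne) andbF /= => /andP[lpo /eqP rev].
by have := reversed_depth xo lpo rev; lia.
Qed.

Lemma deep_compat w : exists N, forall u, N <= dep u -> parent_compat r f w u.
Proof.
elim: w => [|l w [N HN]].
  by exists 1 => u; rewrite lt0n (depth_eq0 r).
have [N1 H1] := deep_parent l; have [N2 H2] := deep_ev w N1.
exists (maxn N N2) => u; rewrite geq_max => /andP[/HN pu /H2/H1[lo lp]].
by rewrite /= pu lo lp -(compat_parent pu) eqxx.
Qed.

Lemma compat_winv w x : parent_compat r f w x -> parent_compat r f (winv w) (ev f w x).
Proof.
elim: w => //= l w IH /and3P[px lo /eqP lp].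
rewrite /winv /= rev_cons -cats1 compat_cat /= lactK IH // lo (compat_neq px) lp lactK.
by rewrite (compat_parent px) eqxx.
Qed.

Definition survivor w u0 := forall m, exists2 u, u \in desc m u0 & ev f w u = u.

(* [D] bounds the depths of the edges; it is kept fixed while the loop is
   rotated and reversed. *)
Definition good_loop D w u0 := [/\ ev f w u0 = u0, uniq (edges f w u0),
  all (fun v => dep v.2 <= D) (edges f w u0), parent_compat r f w u0 & survivor w u0].

(** Rotation conjugates the word: the edges are permuted cyclically, and [w2] carries fixed
    descendants of [u0] to fixed descendants of the new base vertex. *)
Lemma good_loop_rot D w1 w2 u0 : good_loop D (w1 ++ w2) u0 ->
  good_loop D (w2 ++ w1) (ev f w2 u0).
Proof.
rewrite /good_loop !edges_cat !compat_cat => -[wu un al /andP[p2 p1] su].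
move: wu; rewrite !ev_cat => wu; rewrite wu p1 p2; split=> //.
- by rewrite uniq_catC.
- by move: al; rewrite !all_cat andbC.
- move=> m; have [u um] := su m; rewrite ev_cat => eu.
  have [_ ? _ _] := compat_desc p2 um.
  by exists (ev f w2 u) => //; rewrite ev_cat eu.
Qed.

Lemma good_loop_winv D w u0 : good_loop D w u0 -> good_loop D (winv w) u0.
Proof.
move=> [wu un al pu su]; have ewu := edges_winv f w u0; rewrite wu in ewu.
split; rewrite ?ewu ?rev_uniq ?all_rev //.
- by rewrite -[in LHS]wu ev_winv.
- by rewrite -wu; exact: compat_winv.
- by move=> m; have [u um eu] := su m; exists u => //; rewrite -[in LHS]eu ev_winv.
Qed.

Lemma mem_edgesP w x v : v \in edges f w x ->
  exists w1 l w2, w = w1 ++ l :: w2 /\ v = edge f l (ev f w2 x).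
Proof.
elim: w => //= l w IH; rewrite inE => /orP[/eqP ->|/IH[w1 [l' [w2 [-> ->]]]]].
  by exists [::], l, w.
by exists (l :: w1), l', w2.
Qed.

(** Pick a deepest edge. If its letter is positive, rotate it to the right end of the word; if it is
    inverse, rotate it to the left end and invert the word. The vertex of that edge becomes the base
    vertex. *)
Lemma good_loop_base D w u0 : w != [::] -> good_loop D w u0 ->
  exists w' g x0, good_loop (dep x0) (rcons w' (g, false)) x0.
Proof.
move=> w0 gw; have [_ _ _ _ _] := gw.
have [v vw vmax] : exists2 v, v \in edges f w u0 &
    all (fun v' => dep v'.2 <= dep v.2) (edges f w u0).
  have : edges f w u0 != [::] by rewrite -size_eq0 size_edges size_eq0.
  elim: (edges f w u0) => // a [|b s] IH _.
    by exists a; rewrite ?mem_head //= leqnn.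
  have [//|v vs vm] := IH; have [le|lt] := leqP (dep a.2) (dep v.2).
    by exists v; [rewrite inE vs orbT | rewrite /= le].
  exists a; first exact: mem_head.
  rewrite /= leqnn; apply: sub_all vm => v' /leq_trans; apply; exact: ltnW.
have {gw}gw : good_loop (dep v.2) w u0 by case: gw => wu un _ pu su; split.
have [w1 [l [w2 [we ve]]]] := mem_edgesP vw.
case: l we ve => g [] we ve.
- move: gw; rewrite we => /good_loop_rot/good_loop_winv.
  rewrite /winv /= rev_cons ve.
  by exists (rev (map (@flip n) (w2 ++ w1))), g, (ev f ((g, true) :: w2) u0).
- move: gw; rewrite we -cat_rcons => /good_loop_rot.
  rewrite -rcons_cat ve; by exists (w2 ++ w1), g, (ev f w2 u0).
Qed.

Lemma reduced_infix w1 w2 w3 : reduced (w1 ++ w2 ++ w3) -> reduced w2.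
Proof. by apply: infix_sorted; apply/infixP; exists w1, w3. Qed.

Lemma reduced_cons_flip l w : ~~ reduced (l :: flip l :: w).
Proof. by rewrite /reduced /= eqxx; case: l.2. Qed.

(** Otherwise the fixed descendants of each vertex of level [N] miss some generation, at most [M]
    for all of this finite level. As fixedness passes to ancestors down to depth [N], all fixed
    vertices would lie in the ball of radius [N + M]. *)
Lemma survivor_exists w N : infinite_set (fixed_vertices w) ->
  (forall u, N <= dep u -> parent_compat r f w u) ->
  exists2 u0, dep u0 = N & survivor w u0.
Proof.
move=> w_inf deep; apply: contrapT => none.
have H u0 : u0 \in desc N o -> exists m, forall u, u \in desc m u0 -> ev f w u <> u.
  rewrite mem_desc_origin => /eqP du0; apply: contrapT => Hu; apply: none.
  exists u0 => // m; apply: contrapT => Hm; apply: Hu; exists m => u um wu.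
  by apply: Hm; exists u.
have [M HM] : exists M, forall u0, u0 \in desc N o ->
    exists2 m, m <= M & forall u, u \in desc m u0 -> ev f w u <> u.
  elim: (desc N o) H => [|x s IH] H; first by exists 0.
  have [|M HM] := IH; first by move=> u us; apply: H; rewrite inE us orbT.
  have [m Hm] := H x (mem_head _ _).
  exists (maxn M m) => u; rewrite inE => /orP[/eqP->|/HM[m' le Hm']].
    by exists m => //; rewrite leq_maxr.
  by exists m' => //; rewrite leq_max le.
have anc u i : ev f w u = u -> N + i <= dep u ->
    ev f w (iter i par u) = iter i par u /\ dep (iter i par u) = dep u - i.
  move=> wu; elim: i => [|i IH] le /=; first by rewrite subn0.
  have [|wi di] := IH; first by lia.
  have pi : parent_compat r f w (iter i par u) by apply: deep; rewrite di; lia.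
  split; first by rewrite -(compat_parent pi) wi.
  have io : iter i par u != o by rewrite -(depth_eq0 r) di; lia.
  by have := depth_parent io; rewrite di; lia.
apply: w_inf; apply: sub_finite_set (finite_ball (N + M)) => u wu /=.
rewrite leqNgt; apply/negP => lt.
have [|_ d0] := anc u (dep u - N) wu; first by lia.
have [|m mM Hm] := HM (iter (dep u - N) par u).
  by rewrite mem_desc_origin d0; apply/eqP; lia.
have [|wm dm] := anc u (dep u - N - m) wu; first by lia.
apply: (Hm _ _ wm); rewrite mem_desc -iterD dm d0; apply/andP; split.
  by apply/eqP; congr (iter _ _ _); lia.
by apply/eqP; lia.
Qed.

(** * A shortest word with infinitely many fixed vertices *)

Section MinimalWord.
Variable w : word n.
Hypotheses (w_red : reduced w) (w_inf : infinite_set (fixed_vertices w)).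
Hypothesis w_min : forall s : word n, reduced s -> s != [::] ->
  size s < size w -> finite_set (fixed_vertices s).

(** Two uses of one edge bound a subword that fixes a vertex of the trajectory; the signs of the two
    letters decide which of them belong to it. It could be empty only if [w] were not reduced, and
    all of [w] only if [w] were a conjugate of the shorter word [b], which has finitely many fixed
    vertices by minimality. *)
Lemma repeated_edge u : ~~ uniq (edges f w u) ->
  exists w1 s w2, [/\ w = w1 ++ s ++ w2, s != [::], size s < size w &
    fixed_vertices s (ev f w2 u)].
Proof.
suff H w3 w4 : w = w3 ++ w4 -> ~~ uniq (edges f w4 u) ->
  exists w1 s w2, [/\ w = w1 ++ s ++ w2, s != [::], size s < size w &
    fixed_vertices s (ev f w2 u)] by exact: (H [::] w).
elim: w4 w3 => //= l1 w4 IH w3 we; rewrite negb_and negbK => /orP[|nu]; last first.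
  by apply: (IH (rcons w3 l1)) => //; rewrite cat_rcons.
move=> /mem_edgesP[b [l2 [c [w4e ed]]]]; move: we ed; rewrite {}w4e => we.
have sw : size w = size w3 + (size b + (size c).+1).+1.
  by rewrite we size_cat /= size_cat.
rewrite ev_cat /=; case: l1 we => i1 s1; case: l2 => i2 s2.
rewrite /edge /= => we [ii]; rewrite -{}ii in we *.
case: s1 we => we; case: s2 we => we e.
- exists w3, ((i1, true) :: b), ((i1, true) :: c); split=> //=.
  by rewrite sw; lia.
- have sE : (i1, true) :: b ++ (i1, false) :: c =
      ((i1, true) :: rcons b (i1, false)) ++ c.
    by rewrite /= cat_rcons.
  have [wE|wne] := eqVneq w ((i1, true) :: rcons b (i1, false)); last first.
    exists w3, ((i1, true) :: rcons b (i1, false)), c; split=> //=.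
    + by rewrite we sE.
    + rewrite sw size_rcons; have [|] := eqVneq (size w3 + size c) 0; last by lia.
      move/eqP; rewrite addn_eq0 => /andP[/nilP w30 /nilP c0].
      by move: wne; rewrite we w30 c0 cats1 eqxx.
    + by rewrite /fixed_vertices /= -cats1 ev_cat.
  have b_fin : finite_set (fixed_vertices b).
    apply: w_min; last by rewrite wE /= size_rcons; lia.
      have := w_red; rewrite wE -cats1.
      exact: (@reduced_infix [:: (i1, true)] b [:: (i1, false)]).
    apply/eqP => b0; move: w_red; rewrite wE b0; apply/negP.
    exact: (reduced_cons_flip (i1, true) [::]).
  exfalso; apply: w_inf; apply: sub_finite_set (finite_image (lact f (i1, true)) b_fin).
  move=> x; rewrite /fixed_vertices /= wE /= -cats1 ev_cat /= => ex.
  exists (lact f (i1, false) x); last exact: (@lactK _ _ f (i1, false)).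
  by rewrite -[in RHS]ex (@lactK _ _ f (i1, true)).
- exists (rcons w3 (i1, false)), b, ((i1, true) :: c); split=> //=.
  + by rewrite cat_rcons.
  + apply/eqP => b0; move: w_red; rewrite we b0.
    move/(@reduced_infix w3 [:: (i1, false); (i1, true)] c); apply/negP.
    exact: (reduced_cons_flip (i1, false) [::]).
  + by rewrite sw; lia.
- exists (rcons w3 (i1, false)), (rcons b (i1, false)), c; split=> //=.
  + by rewrite !cat_rcons.
  + by case: (b).
  + by rewrite sw size_rcons; lia.
  + by rewrite /fixed_vertices /= -cats1 ev_cat.
Qed.

Lemma deep_uniq : exists N, forall u, N <= dep u -> uniq (edges f w u).
Proof.
(* The pair gives the start and the length of a subword. There are finitely many proper ones, and
   each excludes finitely many starting vertices. *)
pose bad (ij : 'I_(size w).+1 * 'I_(size w).+1) : set T :=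
  [set u | [/\ take ij.2 (drop ij.1 w) != [::],
     size (take ij.2 (drop ij.1 w)) < size w &
     fixed_vertices (take ij.2 (drop ij.1 w)) (ev f (drop ij.2 (drop ij.1 w)) u)]].
have fbad : finite_set (\bigcup_(ij in [set: 'I_(size w).+1 * 'I_(size w).+1]) bad ij).
  apply: bigcup_finite; first exact: finite_finset.
  move=> [i j] _; rewrite /bad /=; set s := take j (drop i w).
  have [s0|s0] := boolP ((s != [::]) && (size s < size w)); last first.
    rewrite (_ : mkset _ = set0) //; apply/seteqP; split=> u // [] /= n1 n2.
    by rewrite n1 n2 in s0.
  have [/andP[n1 n2]] := s0.
  apply: (@sub_finite_set _ _ [set u | fixed_vertices s (ev f (drop j (drop i w)) u)]).
    by move=> u [].
  apply: finite_preimage_ev; apply: w_min => //.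
  apply: (@reduced_infix (take i w) s (drop j (drop i w))).
  by rewrite cat_take_drop cat_take_drop.
have [N HN] := finite_depth fbad; exists N => u; apply: contraTT => /repeated_edge.
move=> [w1 [s [w2 [we s0 ss fs]]]]; rewrite -ltnNge; apply: HN.
have l1 : size w1 < (size w).+1 by rewrite we size_cat; lia.
have l2 : size s < (size w).+1 by rewrite ltnW.
exists (Ordinal l1, Ordinal l2) => //; rewrite /bad /= we drop_size_cat //.
by rewrite take_size_cat // drop_size_cat // -we.
Qed.

End MinimalWord.

Lemma infinite_fixed_loop w : reduced w -> w != [::] ->
  infinite_set (fixed_vertices w) ->
  exists w' g x0, good_loop (dep x0) (rcons w' (g, false)) x0.
Proof.
pose P m := `[< exists w, [/\ reduced w, w != [::],
  infinite_set (fixed_vertices w) & size w = m] >].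
move=> wr w0 winf; have exP : exists m, P m.
  by exists (size w); apply/asboolP; exists w.
case: (ex_minnP exP) => m /asboolP[{w wr w0 winf} w [wr w0 winf <-]] wmin.
have {}wmin s : reduced s -> s != [::] -> size s < size w ->
    finite_set (fixed_vertices s).
  move=> sr s0; rewrite ltnNge => /negP lt; apply: contrapT => sinf; apply: lt.
  by apply: wmin; apply/asboolP; exists s.
have [N1 H1] := deep_uniq wr winf wmin; have [N2 H2] := deep_compat w.
have [|u0 du0 su0] := survivor_exists (N := maxn N1 N2) winf.
  by move=> u; rewrite geq_max => /andP[_ /H2].
(* Any bound on the depths of the edges will do here; [good_loop_base] replaces it by the depth of
   its base vertex. *)
apply: (@good_loop_base (\max_(v <- edges f w u0) dep v.2) w u0 w0).
split=> //.
- by have [u] := su0 0; rewrite mem_seq1 => /eqP ->.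
- by apply: H1; rewrite du0 leq_maxl.
- by apply/allP => v vw; apply: leq_bigmax_seq.
- by apply: H2; rewrite du0 leq_maxr.
Qed.

End Loops.

(** * Generated subgroups and reduced words *)

Section GeneratedWords.
Local Open Scope group_scope.
Variables (G : groupType) (n : nat) (b : 'I_n -> G).

Lemma eval_word_cons l w :
  eval_word b (l :: w) = (if l.2 then (b l.1)^-1 else b l.1) * eval_word b w.
Proof. by rewrite /eval_word big_cons. Qed.

Lemma eval_word_cat w1 w2 :
  eval_word b (w1 ++ w2) = eval_word b w1 * eval_word b w2.
Proof.
elim: w1 => [|l w1 IH]; first by rewrite {2}/eval_word big_nil mul1g.
by rewrite cat_cons !eval_word_cons IH mulgA.
Qed.

Lemma eval_winv w : eval_word b (winv w) = (eval_word b w)^-1.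
Proof.
elim: w => [|l w IH]; first by rewrite /winv /eval_word !big_nil invg1.
rewrite /winv /= rev_cons -cats1 eval_word_cat IH !eval_word_cons.
rewrite [eval_word b [::]]/eval_word big_nil mulg1 invgM.
by congr (_ * _); case: l => i []; rewrite /= ?invgK.
Qed.

Lemma eval_reduced w :
  exists2 w', reduced w' & eval_word b w' = eval_word b w.
Proof.
elim: w => [|l w [w' rw' ew]]; first by exists [::].
rewrite eval_word_cons -ew.
case: w' rw' {ew} => [|l' t] rt; first by exists [:: l] => //; rewrite eval_word_cons.
have [/andP[/eqP ll /eqP ls]|ok] := boolP ((l.1 == l'.1) && (l.2 != l'.2)).
  exists t; first by apply: (@reduced_infix n [:: l'] t [::]); rewrite cats0.
  rewrite eval_word_cons mulgA -ll.
  by case: (l.2) ls; case: (l'.2) => // _; rewrite ?mulVg ?mulgV mul1g.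
by exists [:: l, l' & t]; rewrite ?eval_word_cons // /reduced /= ok.
Qed.

Lemma generated_reduced g : generated (range b) g ->
  exists2 w, reduced w & eval_word b w = g.
Proof.
move=> gG; suff [w _ <-] : [set eval_word b w | w in [set: word n]] g.
  by have [w' rw' ew] := eval_reduced w; exists w'.
apply: gG; split; first split.
- by exists [::] => //; rewrite /eval_word big_nil.
- by move=> _ _ [w1 _ <-] [w2 _ <-]; exists (w1 ++ w2); rewrite // eval_word_cat.
- by move=> _ [w _ <-]; exists (winv w); rewrite // eval_winv.
- move=> _ [i _ <-]; exists [:: (i, false)] => //.
  by rewrite eval_word_cons /eval_word big_nil mulg1.
Qed.

End GeneratedWords.

(** This turns finiteness of fixed vertices into freeness, since a word with trivial value fixes
    every vertex. *)
Lemma infinite_vertices (T : graph) e (r : rooting T e.+2) :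
  is_regular e.+3 T -> infinite_set [set: T].
Proof.
move=> reg /(finite_depth r)[N HN].
suff [x dx] : exists x, (N < depth r x)%N.
  by have := HN x I; rewrite ltnNge (ltnW dx).
elim: N {HN} => [|N [x dx]].
  have [s [_ + +]] := regular_neighbours (origin r) reg.
  case: s => // x s _ /(_ x).
  rewrite mem_head => /esym; rewrite (adjE r) eqxx /= => /andP[xo _].
  by exists x; rewrite lt0n depth_eq0.
have xo : x != origin r by rewrite -(depth_eq0 r) -lt0n (leq_trans _ dx).
by exists (child r x ord0); rewrite (depth_child (mem_child ord0 xo)).
Qed.

Definition vdecode (T : graph) d (r : rooting T d) (i : nat) : T :=
  if unpickle i is Some (m, j) then
    nth (origin r) (desc r m (origin r)) j else origin r.

Lemma vcodeK (T : graph) d (r : rooting T d) : cancel (vcode r) (vdecode r).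
Proof.
by move=> x; rewrite /vdecode /vcode pickleK nth_index // mem_desc_origin.
Qed.

Local Open Scope classical_set_scope.
Local Open Scope ring_scope.

Theorem mainTheorem2 (R : realType) (k : nat) (T : graph) (n : nat)
    (hk : (3 <= k)%N) (hT : is_tree T) (hreg : is_regular k T) (hn : (1 <= n)%N)
    (mu : {measure set (aut T) -> \bar R})
    (hmu : is_haar_measure mu)
    (hnorm : forall x : T, mu (stabilizer x) = 1%E)
    (mun : {measure set (n.-tuple (aut T)) -> \bar R})
    (hmun : is_product_measure mu mun) :
  {ae mun, forall a : n.-tuple (aut T),
    let Gamma := generated (range (tnth a)) in
    free_of_rank n Gamma /\ acts_almost_freely Gamma}.
Proof.
case: k hk hreg => [//|[//|[//|e]]] _ hreg.
have [r] := rooting_exists hT hreg.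
(* One null event for each word, generator, base vertex and code of the action on the root; numbers
   that encode nothing give the empty set. *)
pose V (i : nat) : set (n.-tuple (aut T)) :=
  if unpickle i is Some (w, g, j, c) then
    survives r (w : seq ('I_n * bool)) g (vdecode r j) (c : nat)
  else set0.
have V0 : mun.-negligible (\bigcup_i V i).
  apply: negligible_bigcup => i; rewrite /V.
  case: unpickle => [[[[w g] j] c]|]; last exact: negligible_set0.
  exact: (survives_null r w g (vdecode r j) c hmu hnorm hmun).
apply: negligibleS V0 => a; apply: contra_notP => aV.
have fin w : reduced w -> w <> [::] -> finite_set (fixed_vertices (tnth a) w).
  move=> rw /eqP w0; apply: contrapT => winf; apply: aV.
  have [w' [g [x0 [wx un al px su]]]] := infinite_fixed_loop r rw w0 winf.
  exists (pickle (w' : seq ('I_n * bool), g, vcode r x0, ball_code r 0 a)) => //.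
  by rewrite /V pickleK vcodeK; split.
split.
  (* The generators themselves form a free basis: a relation would be a nonempty reduced word fixing
     infinitely many vertices. *)
  exists (tnth a); split=> // w rw w0 w1; have := fin w rw w0.
  have -> : fixed_vertices (tnth a) w = [set: T].
    by apply/seteqP; split=> x _ //; rewrite /fixed_vertices /= -eval_wordE w1.
  exact: infinite_vertices hreg.
move=> g /generated_reduced[w rw <-] w1.
have [w0|w0] := pselect (w = [::]).
  by case: w1; rewrite w0 /eval_word big_nil.
apply: sub_finite_set (fin w rw w0) => x /=.
by rewrite eval_wordE.
Qed.
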